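(* Let $\mathscr{A}$ be a unital $C^*$-algebra, $\mathscr{E}$ a Hilbert $\mathscr{A}$-module, $\mathscr{E}_1,\mathscr{E}_2$ ternary subspaces of $\mathscr{E}$, and let $z_0\in\mathscr{E}_1\cap\mathscr{E}_2$ be such that $\langle z_0,z_0\rangle=1$. Then $\mathscr{E}_1$ and $\mathscr{E}_2$ are module independent if and only if the $C^*$-subalgebras $[\mathscr{E}_1]$ and $[\mathscr{E}_2]$ of the $C^*$-algebra $[\mathscr{E}]=\mathscr{E}/\{z_0\}^\perp$ are $C^*$-independent.
   Context: A state on a $C^*$-algebra is a positive linear functional of norm one; $S(\mathscr{B})$ is the set of states of $\mathscr{B}$. Hilbert $C^*$-modules are right modules with $\mathscr{A}$-valued inner product $\langle\cdot,\cdot\rangle$, $\mathscr{A}$-linear in the second variable, and $\|x\|=\|\langle x,x\rangle\|^{1/2}$; for $x\in\mathscr{E}$, $|x|=\langle x,x\rangle^{1/2}\in\mathscr{A}$. For a closed subspace $\mathscr{F}\subseteq\mathscr{E}$, $\langle\mathscr{F},\mathscr{F}\rangle$ is the closed linear span of $\{\langle x,y\rangle:x,y\in\mathscr{F}\}$. A closed subspace $\mathscr{F}$ of $\mathscr{E}$ is ternary if $\mathscr{F}\langle\mathscr{F},\mathscr{F}\rangle\subseteq\mathscr{F}$; then $\langle\mathscr{F},\mathscr{F}\rangle$ is a $C^*$-subalgebra of $\mathscr{A}$. Ternary subspaces $\mathscr{E}_1,\mathscr{E}_2$ of $\mathscr{E}$ are (Hilbert $C^*$-)module independent if there are constants $m,M>0$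 such that for all states $\varphi_i\in S(\langle\mathscr{E}_i,\mathscr{E}_i\rangle)$, $i=1,2$, there is a state $\varphi\in S(\mathscr{A})$ with $m\,\varphi_i(|x|)\le\varphi(|x|)\le M\,\varphi_i(|x|^2)^{1/2}$ for all $x\in\mathscr{E}_i$, $i=1,2$. The $C^*$-algebra $[\mathscr{E}]$: for $z_0\in\mathscr{E}$ with $\langle z_0,z_0\rangle=1$, let $\{z_0\}^\perp=\{x\in\mathscr{E}:\langle z_0,x\rangle=0\}$, $[\mathscr{E}]=\mathscr{E}/\{z_0\}^\perp$ and $[x]=x+\{z_0\}^\perp$, so $[x]=[z_0\langle z_0,x\rangle]$. With the natural linear structure, multiplication $[x]\circ[y]=[z_0\langle z_0,x\rangle\langle z_0,y\rangle]$, involution $[x]^\sharp=[z_0\langle x,z_0\rangle]$ and norm $\|[x]\|=\|\langle z_0,x\rangle\|$, $[\mathscr{E}]$ is a $C^*$-algebra with identity $[z_0]$. For a ternary subspace $\mathscr{F}$ containing $z_0$, $[\mathscr{F}]=\{[x]:x\in\mathscr{F}\}$ is a $C^*$-subalgebra of $[\mathscr{E}]$. $C^*$-independence: $C^*$-subalgebras $\mathscr{B}_1,\mathscr{B}_2$ of a $C^*$-algebra $\mathscr{B}$ (all with the same identity) are $C^*$-independent if for every state $\varphi_1$ of $\mathscr{B}_1$ and every state $\varphi_2$ of $\mathscr{B}_2$ there is a state $\varphi$ of $\mathscr{B}$ extending both. *)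

(* Defs.v *)
From HB Require Import structures.
From mathcomp Require Import all_boot all_order all_algebra.
From mathcomp Require Import all_classical all_reals.
From mathcomp Require Import topology normedtype.
From mathcomp Require Import generic_quotient ring_quotient complex.

Set Implicit Arguments.
Unset Strict Implicit.
Unset Printing Implicit Defensive.

Import Order.TTheory GRing.Theory Num.Theory.
Import numFieldNormedType.Exports.

Local Open Scope classical_set_scope.
Local Open Scope ring_scope.
Local Open Scope complex_scope.
Local Open Scope quotient_scope.

Reserved Notation "a ** b" (at level 40, left associativity).
Reserved Notation "x <* a" (at level 40, left associativity).

(* R[i] as a numFieldType, without the reverse_coercion that elaborating     *)
(* R[i] : numFieldType would leave in the terms                              *)
Notation Cfield R := (complex_complex__canonical__Num_NumField R).

(* Unital C*-algebras.  The product is a field of the mixin and not that of  *)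
(* a ringType because Hierarchy Builder rejects any new join of rings and    *)
(* normed Z-modules that numDomainType does not inherit from.  Norms take    *)
(* their values in R[i], as for all normed modules over R[i], where 0 <= z   *)
(* means that z is real and nonnegative.  The zero algebra is not excluded.  *)
HB.mixin Record isCStarAlgebra (R : realType) A
    & CompleteNormedModule (Cfield R) A := {
  csone : A ;
  csmul : A -> A -> A ;
  star : A -> A ;
  csmulA : associative csmul ;
  csmul1l : left_id csone csmul ;
  csmul1r : right_id csone csmul ;
  csmulDl : left_distributive csmul +%R ;
  csmulDr : right_distributive csmul +%R ;
  csmulZl : forall (c : R[i]) (a b : A), csmul (c *: a) b = c *: csmul a b ;
  csmulZr : forall (c : R[i]) (a b : A), csmul a (c *: b) = c *: csmul a b ;
  starK : involutive star ;
  starD : {morph star : a b / a + b} ;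
  starZ : forall (c : R[i]) (a : A), star (c *: a) = c^* *: star a ;
  starM : forall a b : A, star (csmul a b) = csmul (star b) (star a) ;
  csnormM : forall a b : A, `|csmul a b| <= `|a| * `|b| ;
  csnorm_star : forall a : A, `|csmul (star a) a| = `|a| ^+ 2
}.

#[short(type="cstarAlgType")]
HB.structure Definition CStarAlgebra (R : realType) :=
  {A of CompleteNormedModule (Cfield R) A & isCStarAlgebra R A}.

Arguments csone {R A} : rename.
Notation "a ** b" := (csmul a b) : ring_scope.

Definition closed_subspace (R : realType) (V : completeNormedModType (Cfield R))
    (F : set V) :=
  [/\ closed F, F 0 &
      forall (c : R[i]) x y, F x -> F y -> F (c *: x + y)].

Section CStarAlgebraDefs.
Variables (R : realType) (A : cstarAlgType R).
Implicit Types (a b : A) (B : set A) (phi : A -> R[i]).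

Definition cspos a := exists b, a = star b ** b.

(* the positive square root: the unique positive b with b ** b = a *)
Definition cssqrt a : A := get [set b | cspos b /\ b ** b = a].

Definition cstar_subalgebra B :=
  [/\ closed_subspace B,
      forall a b, B a -> B b -> B (a ** b)
    & forall a, B a -> B (star a)].

(* The states of a C*-subalgebra B are the restrictions to B of the phi's    *)
(* below: their values outside B are irrelevant.  Positive elements of B are *)
(* the star b ** b with b in B.  The sup of an unbounded set of reals is 0,  *)
(* so that the last condition also asserts boundedness on the unit ball.     *)
Definition state_on B phi :=
  [/\ forall (c : R[i]) a b, B a -> B b -> phi (c *: a + b) = c * phi a + phi b,
      forall b, B b -> 0 <= phi (star b ** b)
    & sup [set Normc.normc (phi b) | b in [set b | B b /\ `|b| <= 1]] = 1].

Definition state phi := state_on setT phi.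

Definition cstar_independent (B1 B2 : set A) :=
  forall phi1 phi2 : A -> R[i], state_on B1 phi1 -> state_on B2 phi2 ->
  exists2 phi : A -> R[i], state phi &
    (forall b, B1 b -> phi b = phi1 b) /\ (forall b, B2 b -> phi b = phi2 b).

End CStarAlgebraDefs.

(* Right Hilbert A-modules; definiteness of the inner product follows from   *)
(* hmnormE (see inner_eq0 below).                                            *)
HB.mixin Record isHilbertModule (R : realType) (A : cstarAlgType R) E
    & CompleteNormedModule (Cfield R) E := {
  ract : E -> A -> E ;
  inner : E -> E -> A ;
  ractDl : forall (x y : E) (a : A), ract (x + y) a = ract x a + ract y a ;
  ractDr : forall (x : E) (a b : A), ract x (a + b) = ract x a + ract x b ;
  ractZl : forall (c : R[i]) (x : E) (a : A), ract (c *: x) a = c *: ract x a ;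
  ractZr : forall (c : R[i]) (x : E) (a : A), ract x (c *: a) = c *: ract x a ;
  ractM : forall (x : E) (a b : A), ract x (a ** b) = ract (ract x a) b ;
  ract1 : forall x : E, ract x csone = x ;
  innerDr : forall x y z : E, inner x (y + z) = inner x y + inner x z ;
  innerZr : forall (c : R[i]) (x y : E), inner x (c *: y) = c *: inner x y ;
  innerMr : forall (x y : E) (a : A), inner x (ract y a) = inner x y ** a ;
  star_inner : forall x y : E, star (inner x y) = inner y x ;
  inner_pos : forall x : E, cspos (inner x x) ;
  hmnormE : forall x : E, `|x| ^+ 2 = `|inner x x|
}.

#[short(type="hilbertModType")]
HB.structure Definition HilbertModule (R : realType) (A : cstarAlgType R) :=
  {E of CompleteNormedModule (Cfield R) E & isHilbertModule R A E}.

Notation "x <* a" := (ract x a) : ring_scope.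

Section HilbertModuleTheory.
Variables (R : realType) (A : cstarAlgType R) (E : hilbertModType A).
Implicit Types (x y z : E) (a b : A).

Lemma inner0r x : inner x 0 = 0.
Proof. by rewrite -(scale0r 0) innerZr scale0r. Qed.

Lemma innerNr x y : inner x (- y) = - inner x y.
Proof. by rewrite -scaleN1r innerZr scaleN1r. Qed.

Lemma innerBr x y z : inner x (y - z) = inner x y - inner x z.
Proof. by rewrite innerDr innerNr. Qed.

Lemma innerMl x y a : inner (x <* a) y = star a ** inner x y.
Proof. by rewrite -star_inner innerMr starM star_inner. Qed.

Lemma inner_eq0 x : inner x x = 0 -> x = 0.
Proof.
move=> x0; apply/eqP; rewrite -normr_eq0 -sqrf_eq0; apply/eqP.
by rewrite hmnormE x0 normr0.
Qed.

End HilbertModuleTheory.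

Section ModuleIndependence.
Variables (R : realType) (A : cstarAlgType R) (E : hilbertModType A).

Definition hmabs (x : E) : A := cssqrt (inner x x).

Definition inner_span (F : set E) : set A :=
  smallest (@closed_subspace R A) [set inner x y | x in F & y in F].

Definition ternary (F : set E) :=
  closed_subspace F /\ forall x a, F x -> inner_span F a -> F (x <* a).

Definition module_independent (E1 E2 : set E) :=
  exists m M : R, [/\ 0 < m, 0 < M &
    forall phi1 phi2 : A -> R[i],
    state_on (inner_span E1) phi1 -> state_on (inner_span E2) phi2 ->
    exists2 phi : A -> R[i], state phi &
      (forall x, E1 x -> m%:C * phi1 (hmabs x) <= phi (hmabs x) /\
         phi (hmabs x) <= M%:C * sqrtC (phi1 (hmabs x ** hmabs x))) /\
      (forall x, E2 x -> m%:C * phi2 (hmabs x) <= phi (hmabs x) /\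
         phi (hmabs x) <= M%:C * sqrtC (phi2 (hmabs x ** hmabs x)))].

End ModuleIndependence.

Section OrthogonalComplement.
Variables (R : realType) (A : cstarAlgType R) (E : hilbertModType A) (z0 : E).

Definition orth : {pred E} := fun x => inner z0 x == 0.

Lemma orth_zmod_closed : zmod_closed orth.
Proof.
split=> [|x y]; rewrite /orth !unfold_in ?inner0r// => /eqP x0 /eqP y0.
by rewrite innerBr x0 y0 subr0.
Qed.

HB.instance Definition _ := GRing.isZmodClosed.Build E orth orth_zmod_closed.

End OrthogonalComplement.

(* [E] = E / {z0}^perp; the proof of <z0, z0> = 1 is a phantom parameter of  *)
(* the type so that the C*-algebra structure can be inferred from it.        *)
Definition bracket (R : realType) (A : cstarAlgType R) (E : hilbertModType A)
    (z0 : E) (hz0 : inner z0 z0 = csone) : Type := Quotient.quot (orth z0).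

Section Bracket.
Variables (R : realType) (A : cstarAlgType R) (E : hilbertModType A).
Variables (z0 : E) (hz0 : inner z0 z0 = csone).
Local Notation Q := (bracket hz0).

HB.instance Definition _ := GRing.Zmodule.on Q.

Definition brk (x : E) : Q := \pi_(Quotient.quot (orth z0)) x.
Definition brk_repr (u : Q) : E := @repr _ (Quotient.quot (orth z0)) u.

Lemma brk_reprK u : brk (brk_repr u) = u.
Proof. exact: reprK. Qed.

Lemma brk_eqP x y : brk x = brk y <-> inner z0 x = inner z0 y.
Proof.
split=> [/eqP|xy].
  by rewrite -Quotient.idealrBE unfold_in innerBr subr_eq0 => /eqP.
by apply/eqP; rewrite -Quotient.idealrBE unfold_in innerBr xy subrr.
Qed.

Lemma brkD x y : brk (x + y) = brk x + brk y.
Proof. exact: raddfD. Qed.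

(* The operations are computed on representatives; brk_scaleE, brk_normE,    *)
(* brk_mulE and brk_starE below show that they are independent of the choice *)
Definition brk_scale (c : R[i]) (u : Q) : Q := brk (c *: brk_repr u).
Definition brk_norm (u : Q) : R[i] := `|inner z0 (brk_repr u)|.
Definition brk_one : Q := brk z0.
Definition brk_mul (u v : Q) : Q :=
  brk (z0 <* inner z0 (brk_repr u) <* inner z0 (brk_repr v)).
Definition brk_star (u : Q) : Q := brk (z0 <* inner (brk_repr u) z0).

Lemma inner_brk_repr x : inner z0 (brk_repr (brk x)) = inner z0 x.
Proof. by apply/brk_eqP; rewrite brk_reprK. Qed.

Lemma inner_z0 a : inner z0 (z0 <* a) = a.
Proof. by rewrite innerMr hz0 csmul1l. Qed.

Lemma brk_z0 x : brk (z0 <* inner z0 x) = brk x.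
Proof. by apply/brk_eqP; rewrite inner_z0. Qed.

Lemma brk_scaleE c x : brk_scale c (brk x) = brk (c *: x).
Proof. by apply/brk_eqP; rewrite !innerZr inner_brk_repr. Qed.

Lemma brk_normE x : brk_norm (brk x) = `|inner z0 x|.
Proof. by rewrite /brk_norm inner_brk_repr. Qed.

Lemma brk_mulE x y :
  brk_mul (brk x) (brk y) = brk (z0 <* inner z0 x <* inner z0 y).
Proof. by rewrite /brk_mul !inner_brk_repr. Qed.

Lemma brk_starE x : brk_star (brk x) = brk (z0 <* inner x z0).
Proof. by rewrite /brk_star -star_inner inner_brk_repr star_inner. Qed.

Lemma brkW (P : Q -> Prop) : (forall x, P (brk x)) -> forall u, P u.
Proof. by move=> Px u; rewrite -(brk_reprK u). Qed.

Fact brk_scalerA c d u : brk_scale c (brk_scale d u) = brk_scale (c * d) u.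
Proof. by elim/brkW: u => x; rewrite !brk_scaleE scalerA. Qed.

Fact brk_scale1r : left_id 1 brk_scale.
Proof. by elim/brkW=> x; rewrite brk_scaleE scale1r. Qed.

Fact brk_scalerDr : right_distributive brk_scale +%R.
Proof.
by move=> c; elim/brkW=> x; elim/brkW=> y; rewrite !(brk_scaleE, =^~ brkD) scalerDr.
Qed.

Fact brk_scalerDl u : {morph brk_scale^~ u : c d / c + d}.
Proof. by elim/brkW: u => x c d; rewrite !(brk_scaleE, =^~ brkD) scalerDl. Qed.

HB.instance Definition _ := GRing.Zmodule_isLmodule.Build (Cfield R) Q
  brk_scalerA brk_scale1r brk_scalerDr brk_scalerDl.

Lemma brkZ c x : brk (c *: x) = c *: brk x.
Proof. by rewrite -brk_scaleE. Qed.

Lemma brkB x y : brk (x - y) = brk x - brk y.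
Proof. exact: raddfB. Qed.

Fact brk_ler_normD u v : brk_norm (u + v) <= brk_norm u + brk_norm v.
Proof.
elim/brkW: u => x; elim/brkW: v => y.
by rewrite -brkD !brk_normE innerDr ler_normD.
Qed.

Fact brk_normrZ c u : brk_norm (c *: u) = `|c| * brk_norm u.
Proof. by elim/brkW: u => x; rewrite -brkZ !brk_normE innerZr normrZ. Qed.

Fact brk_normr0_eq0 u : brk_norm u = 0 -> u = 0.
Proof.
elim/brkW: u => x; rewrite brk_normE => /normr0_eq0 x0.
have <- : brk 0 = 0 by exact: raddf0.
by apply/brk_eqP; rewrite inner0r.
Qed.

HB.instance Definition _ := Lmodule_isNormed.Build (Cfield R) Q
  brk_ler_normD brk_normrZ brk_normr0_eq0.

Lemma brk_normrE x : `|brk x| = `|inner z0 x|.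
Proof. exact: brk_normE. Qed.

Fact brk_complete (F : set_system Q) : ProperFilter F -> cauchy F -> cvg F.
Proof.
move=> FF /cauchy_ballP Fc.
pose f (u : Q) := inner z0 (brk_repr u).
have fB u v : `|f u - f v| = `|u - v|.
  elim/brkW: u => x; elim/brkW: v => y.
  by rewrite /f !inner_brk_repr -brkB brk_normrE innerBr.
have /cauchy_cvg /cvg_ex[/= a fa] : cauchy (f @ F).
  apply/cauchy_ballP => e e0.
  have [[P1 P2] /= [FP1 FP2] PP] := Fc e e0.
  exists (f @` P1, f @` P2) => /=.
    by split; [apply: filterS FP1 | apply: filterS FP2] => u Pu; exists u.
  move=> [_ _] [/= [u Pu <-] [v Pv <-]].
  have := PP (u, v) (conj Pu Pv).
  by rewrite -!ball_normE /= fB.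
apply/cvg_ex; exists (brk (z0 <* a)); apply/cvgrPdist_lt => e e0.
have /cvgrPdist_lt /(_ e e0) := fa.
apply: filterS => u; rewrite -(fB (brk _)).
by rewrite {2}/f inner_brk_repr inner_z0.
Qed.

HB.instance Definition _ := Uniform_isComplete.Build Q brk_complete.

Fact brk_mulA : associative brk_mul.
Proof.
elim/brkW=> x; elim/brkW=> y; elim/brkW=> z; rewrite !brk_mulE.
by apply/brk_eqP; rewrite !(innerMr, hz0, csmul1l) csmulA.
Qed.

Fact brk_mul1l : left_id brk_one brk_mul.
Proof.
by elim/brkW=> x; rewrite brk_mulE; apply/brk_eqP; rewrite !innerMr hz0 !csmul1l.
Qed.

Fact brk_mul1r : right_id brk_one brk_mul.
Proof.
elim/brkW=> x; rewrite brk_mulE; apply/brk_eqP.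
by rewrite !innerMr hz0 csmul1l csmul1r.
Qed.

Fact brk_mulDl : left_distributive brk_mul +%R.
Proof.
elim/brkW=> x; elim/brkW=> y; elim/brkW=> z.
rewrite !(brk_mulE, =^~ brkD); apply/brk_eqP.
by rewrite !(innerMr, innerDr, hz0, csmul1l, csmulDl).
Qed.

Fact brk_mulDr : right_distributive brk_mul +%R.
Proof.
elim/brkW=> x; elim/brkW=> y; elim/brkW=> z.
rewrite !(brk_mulE, =^~ brkD); apply/brk_eqP.
by rewrite !(innerMr, innerDr, hz0, csmul1l, csmulDr).
Qed.

Fact brk_mulZl (c : R[i]) u v : brk_mul (c *: u) v = c *: brk_mul u v.
Proof.
elim/brkW: u => x; elim/brkW: v => y.
rewrite -brkZ !brk_mulE -brkZ; apply/brk_eqP.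
by rewrite !(innerMr, innerZr, hz0, csmul1l, csmulZl).
Qed.

Fact brk_mulZr (c : R[i]) u v : brk_mul u (c *: v) = c *: brk_mul u v.
Proof.
elim/brkW: u => x; elim/brkW: v => y.
rewrite -brkZ !brk_mulE -brkZ; apply/brk_eqP.
by rewrite !(innerMr, innerZr, hz0, csmul1l, csmulZr).
Qed.

Fact brk_starK : involutive brk_star.
Proof.
elim/brkW=> x; rewrite !brk_starE; apply/brk_eqP.
by rewrite inner_z0 innerMl hz0 csmul1r star_inner.
Qed.

Fact brk_starD : {morph brk_star : u v / u + v}.
Proof.
elim/brkW=> x; elim/brkW=> y; rewrite -brkD !brk_starE -brkD; apply/brk_eqP.
by rewrite innerDr !inner_z0 -[inner (x + y) z0]star_inner innerDr starD !star_inner.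
Qed.

Fact brk_starZ (c : R[i]) u : brk_star (c *: u) = c^* *: brk_star u.
Proof.
elim/brkW: u => x; rewrite -brkZ !brk_starE -brkZ; apply/brk_eqP.
by rewrite innerZr !inner_z0 -[inner (c *: x) z0]star_inner innerZr starZ star_inner.
Qed.

Fact brk_starM u v : brk_star (brk_mul u v) = brk_mul (brk_star v) (brk_star u).
Proof.
elim/brkW: u => x; elim/brkW: v => y; rewrite !(brk_starE, brk_mulE).
apply/brk_eqP; rewrite !(innerMl, innerMr) hz0 !csmul1l csmul1r.
by rewrite !star_inner.
Qed.

Fact brk_normM u v : `|brk_mul u v| <= `|u| * `|v|.
Proof.
elim/brkW: u => x; elim/brkW: v => y; rewrite brk_mulE !brk_normrE.
by rewrite !innerMr hz0 csmul1l csnormM.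
Qed.

Fact brk_norm_star u : `|brk_mul (brk_star u) u| = `|u| ^+ 2.
Proof.
elim/brkW: u => x; rewrite brk_starE brk_mulE !brk_normrE.
by rewrite !(innerMr, hz0, csmul1l) -csnorm_star star_inner.
Qed.

HB.instance Definition _ := isCStarAlgebra.Build R Q
  brk_mulA brk_mul1l brk_mul1r brk_mulDl brk_mulDr brk_mulZl brk_mulZr
  brk_starK brk_starD brk_starZ brk_starM brk_normM brk_norm_star.

Lemma brk_subalgebra (F : set E) : ternary F -> F z0 ->
  cstar_subalgebra (brk @` F) /\ (brk @` F) csone.
Proof.
move=> [[Fcl F0 Flin] Fter] Fz0.
have innerF x y : F x -> F y -> inner_span F (inner x y).
  by move=> Fx Fy B [_]; apply; exists x => //; exists y.
have norm_z0 (a : A) : `|z0 <* a| = `|a|.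
  apply/eqP; rewrite -(@eqrXn2 _ 2)// hmnormE.
  by rewrite innerMl innerMr hz0 csmul1l csnorm_star.
have z0B (a b : A) : z0 <* a - z0 <* b = z0 <* (a - b).
  by rewrite ractDr -[- b]scaleN1r ractZr scaleN1r.
split; last by exists z0.
split; first split.
- elim/brkW=> x /= clx; exists (z0 <* inner z0 x); last exact: brk_z0.
  apply: Fcl => U /nbhs_ballP[e /= e0 xU].
  have [_ [[y Fy <-]]] := clx _ (nbhsx_ballx (brk x) e e0).
  rewrite -ball_normE /= -brkB brk_normrE => xy.
  exists (z0 <* inner z0 y); split; first by apply: Fter => //; exact: innerF.
  by apply: xU; rewrite -ball_normE /= z0B norm_z0 -innerBr.
- by exists 0 => //; exact: raddf0.
- move=> c _ _ [x Fx <-] [y Fy <-]; exists (c *: x + y); first exact: Flin.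
  by rewrite brkD brkZ.
- move=> _ _ [x Fx <-] [y Fy <-]; rewrite [_ ** _]brk_mulE.
  exists (z0 <* inner z0 x <* inner z0 y) => //.
  by do 2!(apply: (Fter); last exact: innerF).
- move=> _ [x Fx <-]; rewrite [star _]brk_starE.
  by exists (z0 <* inner x z0) => //; apply: Fter => //; exact: innerF.
Qed.

End Bracket.

(* Main.v *)
Require Import Defs.
From HB Require Import structures.
From mathcomp Require Import all_boot all_order all_algebra.
From mathcomp Require Import all_classical all_reals.
From mathcomp Require Import topology normedtype complex.
From mathcomp Require Import ring lra.

(* The map [b |-> [z0 b]] is an isometric *-isomorphism of A onto [E] carrying
   B_i = <E_i, E_i> onto [E_i], and |z0 c| = c for c >= 0, so that the theorem is
   about states on the subalgebras B_i of A.  If these are C*-independent, a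
   common extension satisfies the bounds with m = M = 1 by the Schwarz
   inequality.  Conversely, given states phi_i of B_i, Hahn-Banach yields a common
   extension as soon as phi_1 a + phi_2 b <= |a + b| for self-adjoint a in B_1 and
   b in B_2.  Translating by scalars, take a, b >= 0 and states psi_i with
   psi_1 a = |a| and psi_2 b = |b|.  The state phi provided by module independence
   for psi_1 and psi_2 satisfies
   phi (|a| - a) <= M psi_1 ((|a| - a)^2)^(1/2) = 0, and likewise for b, whence
   phi_1 a + phi_2 b <= |a| + |b| <= phi (a + b) <= |a + b|. *)

Set Implicit Arguments.
Unset Strict Implicit.
Unset Printing Implicit Defensive.

Import Order.TTheory GRing.Theory Num.Theory.
Import numFieldNormedType.Exports.

Local Open Scope classical_set_scope.
Local Open Scope complex_scope.
Local Open Scope ring_scope.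

(** * Square roots in C*-algebras *)

Section CStarAlgebraTheory.
Variables (R : realType) (A : cstarAlgType R).
Implicit Types (a b h k p q r s u v x y : A) (c t : R[i]).

Lemma csmul0l a : 0 ** a = 0.
Proof. by rewrite -(scale0r 0) csmulZl !scale0r. Qed.

Lemma csmul0r a : a ** 0 = 0.
Proof. by rewrite -(scale0r 0) csmulZr !scale0r. Qed.

Lemma csmulNl a b : (- a) ** b = - (a ** b).
Proof. by rewrite -scaleN1r csmulZl scaleN1r. Qed.

Lemma csmulNr a b : a ** (- b) = - (a ** b).
Proof. by rewrite -scaleN1r csmulZr scaleN1r. Qed.

Lemma csmulBl a b y : (a - b) ** y = a ** y - b ** y.
Proof. by rewrite csmulDl csmulNl. Qed.

Lemma csmulBr a b y : y ** (a - b) = y ** a - y ** b.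
Proof. by rewrite csmulDr csmulNr. Qed.

Lemma starZ_ge0 c a : 0 <= c -> star (c *: a) = c *: star a.
Proof. by move=> c0; rewrite starZ geC0_conj. Qed.

Lemma star0 : star 0 = 0 :> A.
Proof. by rewrite -(scale0r 0) starZ_ge0// !scale0r. Qed.

Lemma starN a : star (- a) = - star a.
Proof. by apply/eqP; rewrite -subr_eq0 opprK -starD addNr star0. Qed.

Lemma starB a b : star (a - b) = star a - star b.
Proof. by rewrite starD starN. Qed.

Lemma star1 : star csone = csone :> A.
Proof. by rewrite -[RHS]starK -[star csone in RHS]csmul1r starM starK csmul1r. Qed.

Lemma norm_star a : `|star a| = `|a|.
Proof.
have le b : `|b| <= `|star b|.
  have [->|b0] := eqVneq b 0; first by rewrite normr0.
  by rewrite -(@ler_pM2r _ `|b|) ?normr_gt0// -expr2 -csnorm_star csnormM.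
by apply: le_anti; rewrite le andbT -{2}(starK a) le.
Qed.

(** Only an inequality, since the zero algebra, whose unit has norm 0, is allowed. *)
Lemma norm_csone : `|csone : A| <= 1.
Proof.
have [->|b0] := eqVneq (csone : A) 0; first by rewrite normr0.
rewrite -(@ler_pM2r _ `|csone : A|) ?normr_gt0// -expr2 -csnorm_star.
by rewrite star1 csmul1r mul1r.
Qed.

Lemma norm_scale1 c : `|c *: (csone : A)| <= `|c|.
Proof. by rewrite normrZ ler_piMr// norm_csone. Qed.

Lemma norm_sa_sq h : star h = h -> `|h ** h| = `|h| ^+ 2.
Proof. by move=> hs; rewrite -csnorm_star hs. Qed.

Lemma sa_sq_eq0 h : star h = h -> h ** h = 0 -> h = 0.
Proof.
move=> /norm_sa_sq hs h0; apply/eqP; rewrite -normr_eq0 -sqrf_eq0.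
by rewrite -hs h0 normr0.
Qed.

Lemma scale_half_addrr (x : A) : 2^-1 *: (x + x) = x.
Proof. by rewrite -mulr2n -(scaler_nat 2 x) scalerA mulVf ?scale1r// pnatr_eq0. Qed.

(* [star w ** w = h ** h + k ** k] for [w = h + i k] *)
Lemma norm_commuting_squares h k c : star h = h -> star k = k ->
  h ** k = k ** h -> h ** h + k ** k = c *: csone -> `|h| ^+ 2 <= `|c|.
Proof.
move=> hs ks hk hkc; pose w := h + 'i *: k.
have ws : star w = h - 'i *: k.
  by rewrite /w starD starZ hs ks conjCi scaleNr.
have : star w ** w = c *: csone.
  rewrite ws /w csmulBl !csmulDr !csmulZl !csmulZr scalerA.
  by rewrite -expr2 sqrCi scaleN1r hk opprD opprK addrA addrK.
move/(congr1 Num.norm); rewrite csnorm_star => wc.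
rewrite (le_trans _ (norm_scale1 c))// -wc lerXn2r ?nnegrE//.
rewrite -(scale_half_addrr h); have -> : h + h = w + star w.
  by rewrite ws /w addrACA addrN addr0.
rewrite normrZ ger0_norm ?invr_ge0 ?ler0n//.
rewrite ler_pdivrMl ?ltr0n// (le_trans (ler_normD _ _))//.
by rewrite norm_star mulr_natl mulr2n.
Qed.

(* [1 - sqgap n] is the scalar iteration [sqit] below for [u = 1]; it dominates
   [sqit u n] for [`|u| <= 1], so that no estimate on power series is needed. *)
Fixpoint sqgap n : R :=
  if n is n'.+1 then sqgap n' - sqgap n' ^+ 2 / 2 else 1.

Lemma sqgap_itv n : 0 <= sqgap n <= 1.
Proof.
elim: n => [|n /andP[g0 g1]] /=; first by rewrite ler01 lexx.
by apply/andP; split; nra.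
Qed.

(** The recursion makes the inverse of the gap grow by at least 1/2 at each step. *)
Lemma sqgap_le n : sqgap n <= 2 / n.+2%:R.
Proof.
elim: n => [|n IH] /=; first by rewrite divff// pnatr_eq0.
have /andP[g0 g1] := sqgap_itv n.
have n0 : 0 <= n%:R :> R by [].
rewrite ler_pdivlMr ?ltr0n//; rewrite ler_pdivlMr ?ltr0n// in IH.
rewrite -addn2 natrD in IH; rewrite -[n.+3]addn3 natrD.
have : 0 <= (2 - sqgap n * (n%:R + 2)) * (1 - sqgap n / 2).
  by apply: mulr_ge0; lra.
by have := sqr_ge0 (sqgap n); lra.
Qed.

(* an iteration for the fixed point [1 - sqrt (1 - u)] of [s = (u + s ^ 2) / 2] *)
Fixpoint sqit u n : A :=
  if n is n'.+1 then 2^-1 *: (u + sqit u n' ** sqit u n') else 0.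

(** An intertwiner [y] covers commutation ([u = v]) and, in the limit, uniqueness ([y = csone]) as
    well as square roots of intertwined elements. *)
Lemma sqit_intertwine y u v n : y ** u = v ** y ->
  y ** sqit u n = sqit v n ** y.
Proof.
move=> yuv; elim: n => [|n IH] /=; first by rewrite csmul0r csmul0l.
by rewrite csmulZr csmulZl csmulDr csmulDl yuv csmulA IH -csmulA IH csmulA.
Qed.

Lemma sqit_comm u m n : sqit u m ** sqit u n = sqit u n ** sqit u m.
Proof. by apply: sqit_intertwine; apply/esym/sqit_intertwine. Qed.

Lemma star_sqit u n : star u = u -> star (sqit u n) = sqit u n.
Proof.
move=> us; elim: n => [|n IH] /=; first exact: star0.
by rewrite starZ_ge0 ?invr_ge0// starD starM IH us.
Qed.

Lemma norm_sqit u n : `|u| <= 1 -> `|sqit u n| <= (1 - sqgap n)%:C%C.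
Proof.
move=> u1; elim: n => [|n IH] /=; first by rewrite normr0 subrr.
rewrite normrZ ger0_norm ?invr_ge0// ler_pdivrMl ?ltr0n//.
rewrite (le_trans (ler_normD _ _))//.
rewrite (le_trans (lerD u1 (csnormM _ _)))// -expr2.
rewrite (@le_trans _ _ (1 + (1 - sqgap n)%:C%C ^+ 2))//.
  by rewrite lerD2l lerXn2r ?nnegrE// (le_trans _ IH).
rewrite -rmorphXn -(rmorph_nat (real_complex R)) -(rmorph1 (real_complex R)).
by rewrite -rmorphD -rmorphM lecR; lra.
Qed.

Lemma norm_sqitS u n : `|u| <= 1 ->
  `|sqit u n.+1 - sqit u n| <= (sqgap n - sqgap n.+1)%:C%C.
Proof.
move=> u1; elim: n => [|n IH].
  rewrite /= csmul0l addr0 subr0 normrZ ger0_norm ?invr_ge0//.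
  rewrite ler_pdivrMl ?ltr0n// (le_trans u1)//.
  rewrite -(rmorph_nat (real_complex R)) -(rmorph1 (real_complex R)).
  by rewrite -rmorphM lecR; lra.
set s := sqit u n in IH *; set s' := sqit u n.+1 in IH *.
(* The iterates commute, so the difference of squares factors; the scalar gaps satisfy the same
   identity. *)
have -> : sqit u n.+2 - s' = 2^-1 *: ((s' - s) ** (s' + s)).
  rewrite /s' /= -/s -/s' -scalerBr opprD addrACA subrr add0r.
  congr (_ *: _); rewrite -[_ *: _]/(sqit u n.+1) -/s' csmulBl !csmulDr.
  by rewrite [s ** s']sqit_comm opprD addrA addrK.
rewrite normrZ ger0_norm ?invr_ge0// ler_pdivrMl ?ltr0n//.
rewrite (le_trans (csnormM _ _))//.
have le2 : `|s' + s| <= (1 - sqgap n.+1 + (1 - sqgap n))%:C%C.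
  by rewrite rmorphD (le_trans (ler_normD _ _))// lerD// norm_sqit.
rewrite (le_trans (ler_pM _ _ IH le2))//.
rewrite -(rmorph_nat (real_complex R)) -!rmorphM lecR /=; lra.
Qed.

Lemma sqit_cauchy u n m : `|u| <= 1 -> (n <= m)%N ->
  `|sqit u m - sqit u n| <= (sqgap n - sqgap m)%:C%C.
Proof.
move=> u1 /subnK <-; elim: (m - n)%N => [|k IH]; first by rewrite !subrr normr0.
rewrite addSn -(subrKA (sqit u (k + n))) (le_trans (ler_normD _ _))//.
rewrite (le_trans (lerD (norm_sqitS _ u1) IH))//.
by rewrite -rmorphD lecR; lra.
Qed.

Lemma inv_nat_small c (e : R[i]) : 0 <= c -> 0 < e ->
  exists n, c / n.+1%:R < e.
Proof.
move=> c0 e0.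
have /complex_realP[d dE] : e \is Num.real by exact: gtr0_real.
have /complex_realP[k kE] : c \is Num.real by exact: ger0_real.
rewrite dE -(rmorph0 (real_complex R)) ltcR in e0 *; rewrite kE ler0c in c0 *.
exists (Num.bound (k / d)).
rewrite -(rmorph_nat (real_complex R)) -fmorphV -rmorphM ltcR.
rewrite ltr_pdivrMr ?ltr0n// mulrC -ltr_pdivrMr//.
rewrite (lt_le_trans (archi_boundP _)) ?divr_ge0 ?(ltW e0)//.
by rewrite ler_nat leqW.
Qed.

Lemma norm_small_eq0 (x : A) c : 0 <= c ->
  (forall n, `|x| <= c / n.+1%:R) -> x = 0.
Proof.
move=> c0 xc; apply/eqP/contraT; rewrite -normr_gt0 => x0.
have [n] := inv_nat_small c0 x0.
by move=> /(le_lt_trans (xc n)); rewrite ltxx.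
Qed.

(** Convergence with an explicit rate: properties of [s] then follow from norm estimates at each
    [n]. *)
Definition sqlim u s := forall n, `|s - sqit u n| <= 2 / n.+1%:R.

Lemma sqit_dist u n m : `|u| <= 1 -> (n <= m)%N ->
  `|sqit u m - sqit u n| <= 2 / n.+1%:R.
Proof.
move=> u1 nm; rewrite (le_trans (sqit_cauchy u1 nm))//.
rewrite -!(rmorph_nat (real_complex R)) -fmorphV -rmorphM lecR.
have /andP[g0 _] := sqgap_itv m.
apply: le_trans (_ : _ <= sqgap n) _; first by rewrite lerBlDr lerDl.
rewrite (le_trans (sqgap_le n))// ler_pM2l ?ltr0n//.
by rewrite lef_pV2 ?posrE ?ltr0n// ler_nat.
Qed.

Lemma sqlim_exists u : `|u| <= 1 -> exists s, sqlim u s.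
Proof.
move=> u1.
have /cauchy_cvg /cvg_ex[/= s sl] : cauchy (sqit u @ \oo).
  (* The 4 accounts for two distances to [sqit u N], one for each member of the pair. *)
  apply/cauchy_ballP => e e0; have [N Ne] := @inv_nat_small 4 e (ler0n _ _) e0.
  have near_N : (sqit u @ \oo) [set a | `|a - sqit u N| <= 2 / N.+1%:R].
    by exists N => // m /= Nm; exact: sqit_dist.
  exists ([set a | `|a - sqit u N| <= 2 / N.+1%:R],
          [set a | `|a - sqit u N| <= 2 / N.+1%:R]) => //=.
  move=> [a b] [/= aN bN]; rewrite -ball_normE /=.
  rewrite (le_lt_trans _ Ne)// -(subrKA (sqit u N)) (le_trans (ler_normD _ _))//.
  have -> : 4 = 2 + 2 :> R[i] by rewrite -natrD.
  by rewrite mulrDl lerD// distrC.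
exists s => n.
have /cvgrPdist_lt sl' := sl.
apply/ler_addgt0Pl => e /sl'[N _ NE].
have /= := NE (maxn N n) (leq_maxl _ _) => se.
rewrite -(subrKA (sqit u (maxn N n))) (le_trans (ler_normD _ _))//.
by rewrite lerD ?(ltW se)// sqit_dist// leq_maxr.
Qed.

(** The iterates are intertwined exactly, so the defect is at most 4 |y| / (n + 1) for every n. *)
Lemma sqlim_intertwine y u v s s' : sqlim u s -> sqlim v s' ->
  y ** u = v ** y -> y ** s = s' ** y.
Proof.
move=> us vs yuv; apply/eqP; rewrite -subr_eq0; apply/eqP.
apply: (@norm_small_eq0 _ (4 * `|y|)) => [|n]; first by rewrite mulr_ge0.
have -> : y ** s - s' ** y = y ** (s - sqit u n) - (s' - sqit v n) ** y.
  by rewrite csmulBr csmulBl (sqit_intertwine _ yuv) opprB addrA subrK.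
rewrite (le_trans (ler_normB _ _))// (le_trans (lerD (csnormM _ _) (csnormM _ _)))//.
have -> : 4 * `|y| / n.+1%:R = `|y| * (2 / n.+1%:R) + 2 / n.+1%:R * `|y|.
  by rewrite (mulrC (2 / _) `|y|) -mulrDr -mulrDl -natrD mulrA (mulrC 4).
by rewrite lerD ?ler_wpM2l ?ler_wpM2r.
Qed.

Lemma sqlim_unique u s s' : sqlim u s -> sqlim u s' -> s = s'.
Proof.
move=> us ut; rewrite -[s]csmul1l -[s']csmul1r.
by apply: sqlim_intertwine us ut _; rewrite csmul1l csmul1r.
Qed.

Lemma sqlim_star u s : star u = u -> sqlim u s -> star s = s.
Proof.
move=> uu us; apply: sqlim_unique (us) => n.
by rewrite -(star_sqit n uu) -starB norm_star; exact: us.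
Qed.

Lemma sqlim_norm u s : `|u| <= 1 -> sqlim u s -> `|s| <= 1.
Proof.
move=> u1 us; apply/ler_addgt0Pl => e e0.
have [n ne] := @inv_nat_small 2 e (ler0n _ _) e0.
rewrite -(subrK (sqit u n) s) (le_trans (ler_normD _ _))//.
apply: lerD; first exact: le_trans (us n) (ltW ne).
rewrite (le_trans (norm_sqit n u1))// -(rmorph1 (real_complex R)) lecR.
by rewrite lerBlDr lerDl; have /andP[] := sqgap_itv n.
Qed.

Lemma sqlim_fixpoint u s : `|u| <= 1 -> sqlim u s -> s + s = u + s ** s.
Proof.
move=> u1 us; apply/eqP; rewrite -subr_eq0; apply/eqP.
have s1 := sqlim_norm u1 us.
(* The defect splits into four errors, each at most 2 / (n + 1). *)
apply: (@norm_small_eq0 _ 8) => [|n]; first exact: ler0n.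
have nn : 2 / n.+2%:R <= 2 / n.+1%:R :> R[i].
  by rewrite ler_pM2l ?ltr0n// lef_pV2 ?posrE ?ltr0n// ler_nat.
set s1' := sqit u n.+1; set s0 := sqit u n.
have -> : s + s - (u + s ** s) =
    ((s - s1') + (s - s1')) - ((s - s0) ** s0 + s ** (s - s0)).
  have -> : (s - s0) ** s0 + s ** (s - s0) = s ** s - s0 ** s0.
    by rewrite csmulBl csmulBr addrC addrA subrK.
  rewrite addrACA -opprD.
  have -> : s1' + s1' = u + s0 ** s0.
    by rewrite /s1' /= -/s0 -scalerDr scale_half_addrr.
  by rewrite -[RHS]addrA -opprD -(addrA u) [s0 ** s0 + _]addrC subrK.
rewrite (le_trans (ler_normB _ _))//.
have -> : 8 / n.+1%:R = (2 / n.+1%:R + 2 / n.+1%:R) + (2 / n.+1%:R + 2 / n.+1%:R) :> R[i].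
  by rewrite -!mulrDl -!natrD.
have sle := us n; rewrite -/s0 in sle.
have s0le : `|s0| <= 1.
  rewrite (le_trans (norm_sqit n u1))// -(rmorph1 (real_complex R)) lecR.
  by rewrite lerBlDr lerDl; have /andP[] := sqgap_itv n.
apply: lerD; rewrite (le_trans (ler_normD _ _))//.
  by rewrite lerD// (le_trans (us _)).
apply: lerD; rewrite (le_trans (csnormM _ _))//.
  by rewrite -[leRHS]mulr1 ler_pM.
by rewrite -[leRHS]mul1r ler_pM.
Qed.

Lemma sqlim_closed (B : set A) u s : closed_subspace B ->
  (forall a b, B a -> B b -> B (a ** b)) -> B u -> sqlim u s -> B s.
Proof.
move=> [Bcl B0 Blin] BM Bu us; apply: (Bcl) => U /nbhs_ballP[e /= e0 sU].
have BS n : B (sqit u n).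
  elim: n => [|n IH] //=.
  rewrite -[_ *: _]addr0; apply: (Blin) => //.
  by rewrite -[X in X + _]scale1r; apply: (Blin) => //; exact: BM.
have [n ne] := @inv_nat_small 2 e (ler0n _ _) e0.
exists (sqit u n); split; first exact: BS.
by apply: sU; rewrite -ball_normE /=; exact: le_lt_trans (us n) ne.
Qed.

End CStarAlgebraTheory.

(** * Positive elements *)

Section Positivity.
Variables (R : realType) (A : cstarAlgType R).
Implicit Types (a b h k p q r s u v x y : A) (c t : R[i]) (B : set A).

(* For self-adjoint [a], this says that the spectrum of [a] lies in [[0, 2 t]]. *)
Definition pos a := star a = a /\ exists t : R[i], `|t *: csone - a| <= t.

Lemma pos0 : pos 0.
Proof. by split; [exact: star0 | exists 0; rewrite scale0r subr0 normr0]. Qed.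

Lemma posD a b : pos a -> pos b -> pos (a + b).
Proof.
move=> [sa [t ta]] [sb [t' tb]]; split; first by rewrite starD sa sb.
by exists (t + t'); rewrite scalerDl opprD addrACA (le_trans (ler_normD _ _))// lerD.
Qed.

Lemma posZ c a : 0 <= c -> pos a -> pos (c *: a).
Proof.
move=> c0 [sa [t ta]]; split; first by rewrite starZ_ge0// sa.
by exists (c * t); rewrite -scalerA -scalerBr normrZ ger0_norm// ler_wpM2l.
Qed.

(** Lets the radius in [pos] be enlarged, to make it nonzero or common to two elements. *)
Lemma pos_bound_le a t t' : `|t *: csone - a| <= t -> t <= t' ->
  `|t' *: csone - a| <= t'.
Proof.
move=> ta tt'; rewrite -(subrK (t *: csone) (t' *: csone)) -addrA.
rewrite (le_trans (ler_normD _ _))// -scalerBl.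
rewrite (le_trans (lerD (norm_scale1 _ _) ta))//.
by rewrite ger0_norm ?subr_ge0// subrK.
Qed.

(* [sqlim (1 - a / t) s] makes [1 - s] a square root of [a / t]. *)
Definition root_at t a r :=
  exists2 s, sqlim (csone - t^-1 *: a) s & r = sqrtC t *: (csone - s).

Section RootAt.
Variables (t : R[i]) (a : A).
Hypotheses (t0 : 0 < t) (sa : star a = a) (ta : `|t *: csone - a| <= t).

Let sqrtt0 : 0 <= sqrtC t. Proof. by rewrite sqrtC_ge0 ltW. Qed.

Let normu : `|csone - t^-1 *: a| <= 1.
Proof.
rewrite -[csone](scalerK (lt0r_neq0 t0)) -scalerBr normrZ.
by rewrite gtr0_norm ?invr_gt0// ler_pdivrMl// mulr1.
Qed.

Lemma root_at_exists : exists r, root_at t a r.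
Proof. by have [s us] := sqlim_exists normu; exists (sqrtC t *: (csone - s)), s. Qed.

Lemma root_at_sq r : root_at t a r -> r ** r = a.
Proof.
move=> [s us ->]; rewrite csmulZl csmulZr scalerA -expr2 sqrtCK.
rewrite csmulBl !csmulBr !csmul1l csmul1r.
(* The fixed point equation for [s] turns (1 - s)^2 into 1 - u with u = 1 - a / t. *)
have -> : csone - s - (s - s ** s) = csone - (csone - t^-1 *: a).
  rewrite -addrA -opprD; congr (_ - _).
  by rewrite addrA (sqlim_fixpoint normu us) addrK.
by rewrite opprB addrCA subrr addr0 scalerA mulfV ?scale1r// gt_eqF.
Qed.

Lemma root_at_pos r : root_at t a r -> pos r.
Proof.
move=> [s us ->]; apply: posZ => //; split.
  by rewrite starB star1 (sqlim_star _ us)// starB star1 starZ_ge0 ?sa// invr_ge0 ltW.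
exists 1; rewrite scale1r opprB addrCA subrr addr0.
exact: sqlim_norm us.
Qed.

Lemma root_at_closed B r : cstar_subalgebra B -> B csone -> B a ->
  root_at t a r -> B r.
Proof.
move=> [[Bcl B0 Blin] BM _] B1 Ba [s us ->].
have BB x y : B x -> B y -> B (x - y).
  by move=> Bx By; rewrite addrC -scaleN1r; exact: Blin.
have BZ c x : B x -> B (c *: x) by move=> Bx; rewrite -[_ *: _]addr0; exact: Blin.
apply: (BZ); apply: (BB) => //; apply: (sqlim_closed _ BM _ us) => //.
by apply: (BB) => //; exact: BZ.
Qed.

End RootAt.

Lemma root_at_intertwine t y a b r r' : root_at t a r -> root_at t b r' ->
  y ** a = b ** y -> y ** r = r' ** y.
Proof.
move=> [s us ->] [s' us' ->] yab; rewrite csmulZr csmulZl; congr (_ *: _).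
rewrite csmulBr csmulBl csmul1r csmul1l; congr (_ - _).
apply: (sqlim_intertwine us us').
by rewrite csmulBr csmulBl csmul1r csmul1l csmulZr csmulZl yab.
Qed.

(** The root is a norm limit of polynomials in [a], whence the last two clauses; they take the place
    of a continuous functional calculus. *)
Lemma pos_root a : pos a -> exists r, [/\ pos r, r ** r = a,
  forall y, y ** a = a ** y -> y ** r = r ** y &
  forall B, cstar_subalgebra B -> B csone -> B a -> B r].
Proof.
move=> [sa [t ta]].
have t0 : 0 <= t := le_trans (normr_ge0 _) ta.
(* [root_at] divides by the radius, and [t] may be 0. *)
have {}ta : `|(t + 1) *: csone - a| <= t + 1.
  by apply: pos_bound_le ta _; rewrite lerDl.
have {}t0 : 0 < t + 1 by rewrite ltr_wpDl.
have [r ar] := root_at_exists t0 ta; exists r; split.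
- exact: root_at_pos ar.
- exact: root_at_sq ar.
- by move=> y; apply: (root_at_intertwine ar).
- by move=> B BB B1 Ba; exact: (root_at_closed BB B1 Ba ar).
Qed.

(** The roots h of a and k of - a commute and h^2 + k^2 = 0, so [norm_commuting_squares] gives h =
    0. *)
Lemma pos_antisym a : pos a -> pos (- a) -> a = 0.
Proof.
move=> /pos_root[h [[hs _] ha _ _]] /pos_root[k [[ks _] ka kcomm _]].
have hk : h ** k = k ** h.
  by apply: kcomm; rewrite csmulNl csmulNr -ha csmulA.
have : `|h| ^+ 2 <= `|0 : R[i]|.
  by apply: norm_commuting_squares hk _; rewrite // ha ka subrr scale0r.
rewrite normr0 -norm_sa_sq// ha normr_le0 => /eqP.
by [].
Qed.

Lemma pos_add_eq0 a b : pos a -> pos b -> a + b = 0 -> a = 0.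
Proof.
by move=> pa pb /eqP; rewrite addrC addr_eq0 => /eqP ab; apply: pos_antisym; rewrite -?ab.
Qed.

(** Again by [norm_commuting_squares], for the roots of a and c - a. *)
Lemma pos_le_norm a c : pos a -> pos (c *: csone - a) -> `|a| <= `|c|.
Proof.
move=> /pos_root[h [[hs _] ha _ _]] /pos_root[k [[ks _] ka kcomm _]].
rewrite -ha norm_sa_sq//; apply: (@norm_commuting_squares _ _ _ k) => //.
  apply: kcomm; rewrite csmulBl csmulBr csmulZl csmulZr csmul1l csmul1r.
  by rewrite -ha csmulA.
by rewrite ha ka addrC subrK.
Qed.

(** Scale to g of norm one and let s solve s + s = g^2 + s^2. Then (1 - s)^2 + g^2 = 1 with
    commuting terms, so [norm_commuting_squares] bounds the norm of 1 - g^2 = (1 - s)^2 by 1. *)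
Lemma pos_sa_sq h : star h = h -> pos (h ** h).
Proof.
move=> hs; have [->|h0] := eqVneq h 0; first by rewrite csmul0l; exact: pos0.
have c0 : 0 < `|h| by rewrite normr_gt0.
pose g := `|h|^-1 *: h.
have gs : star g = g by rewrite /g starZ_ge0 ?hs// invr_ge0.
have hg : h = `|h| *: g by rewrite /g scalerKV// gt_eqF.
have gn : `|g| = 1.
  by rewrite /g normrZ ger0_norm ?invr_ge0// mulVf// gt_eqF.
rewrite hg csmulZl csmulZr scalerA; apply: posZ; first by rewrite mulr_ge0.
have un : `|g ** g| <= 1 by rewrite norm_sa_sq// gn expr1n.
split; first by rewrite starM gs.
exists 1; have [s us] := sqlim_exists un.
have ss : star s = s by apply: sqlim_star us; rewrite starM gs.
have sg : g ** s = s ** g by apply: (sqlim_intertwine us us); rewrite csmulA.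
have ks : star (csone - s) = csone - s by rewrite starB star1 ss.
have kk : (csone - s) ** (csone - s) = csone - g ** g.
  rewrite csmulBl !csmulBr !csmul1l csmul1r.
  rewrite -addrA -opprD; congr (_ - _).
  by rewrite addrA (sqlim_fixpoint un us) addrK.
rewrite scale1r -kk norm_sa_sq// -[leRHS]normr1.
apply: (@norm_commuting_squares _ _ _ g) => //.
  by rewrite csmulBl csmulBr csmul1l csmul1r sg.
by rewrite kk subrK scale1r.
Qed.

(** The roots commute as well, so the product is the square of their self-adjoint product. *)
Lemma posM a b : pos a -> pos b -> a ** b = b ** a -> pos (a ** b).
Proof.
move=> /pos_root[p [[ps _] <- pcomm _]] /pos_root[q [[qs _] <- qcomm _]] ab.
have pq : p ** q = q ** p by apply/esym/pcomm/esym/qcomm.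
have -> : p ** p ** (q ** q) = (p ** q) ** (p ** q).
  by rewrite !csmulA -(csmulA p q p) -pq csmulA.
by apply: pos_sa_sq; rewrite starM ps qs.
Qed.

(** Both are compared with the root r from [pos_root], which commutes with them. For d = x - r, the
    positive elements d^2 x and d^2 r add up to d (x^2 - r^2) = 0, so both vanish and d^3 = 0. *)
Lemma pos_sqrt_unique p q : pos p -> pos q -> p ** p = q ** q -> p = q.
Proof.
suff root_eq x r : pos x -> pos r -> r ** r = x ** x ->
    (forall y, y ** (x ** x) = (x ** x) ** y -> y ** r = r ** y) -> x = r.
  move=> pp qp pq.
  have [r [rp rr rcomm _]] := pos_root (pos_sa_sq pp.1).
  rewrite (root_eq p r pp rp rr rcomm).
  by symmetry; apply: root_eq => //; rewrite -pq.
move=> px pr rr rcomm.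
have xr : x ** r = r ** x by apply: rcomm; rewrite csmulA.
have ds : star (x - r) = x - r by rewrite starB px.1 pr.1.
set d := x - r in ds *.
have dx : d ** x = x ** d by rewrite /d csmulBl csmulBr xr.
have dr : d ** r = r ** d by rewrite /d csmulBl csmulBr xr.
have ddpos z : pos z -> d ** z = z ** d -> pos (d ** d ** z).
  move=> pz dz; apply: posM => //; first exact: pos_sa_sq.
  by rewrite -csmulA dz csmulA dz csmulA.
have ddsum : d ** d ** x + d ** d ** r = 0.
  rewrite -csmulDr -csmulA; rewrite [d ** (x + r)](_ : _ = 0) ?csmul0r//.
  by rewrite /d csmulBl !csmulDr rr xr [_ + r ** x]addrC subrr.
have ddx := pos_add_eq0 (ddpos _ px dx) (ddpos _ pr dr) ddsum.
have ddr : d ** d ** r = 0 by move: ddsum; rewrite ddx add0r.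
have ddd : d ** d ** d = 0 by rewrite {3}/d csmulBr ddx ddr subr0.
have /eqP : d = 0.
  apply: sa_sq_eq0 => //; apply: sa_sq_eq0; first by rewrite starM ds.
  by rewrite csmulA ddd csmul0l.
by rewrite subr_eq0 => /eqP.
Qed.

(** A common radius puts both squares under the same iteration, whose limits are intertwined;
    uniqueness of roots identifies the results with [p] and [q]. *)
Lemma pos_intertwine y p q : pos p -> pos q ->
  y ** (p ** p) = (q ** q) ** y -> y ** p = q ** y.
Proof.
move=> pp qp yy.
have [spp [t tp]] := pos_sa_sq pp.1; have [sqq [t' tq]] := pos_sa_sq qp.1.
have t0 : 0 <= t := le_trans (normr_ge0 _) tp.
have t'0 : 0 <= t' := le_trans (normr_ge0 _) tq.
have T0 : 0 < t + t' + 1 by rewrite ltr_wpDl// addr_ge0.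
have {}tp : `|(t + t' + 1) *: csone - p ** p| <= t + t' + 1.
  by apply: pos_bound_le tp _; rewrite -addrA lerDl addr_ge0.
have {}tq : `|(t + t' + 1) *: csone - q ** q| <= t + t' + 1.
  by apply: pos_bound_le tq _; rewrite addrAC addrC lerDl addr_ge0.
have [r pr] := root_at_exists T0 tp.
have [r' qr'] := root_at_exists T0 tq.
rewrite (@pos_sqrt_unique p r) ?(root_at_sq T0 tp pr)//; last exact: root_at_pos pr.
rewrite (@pos_sqrt_unique q r') ?(root_at_sq T0 tq qr')//; last exact: root_at_pos qr'.
exact: (root_at_intertwine pr qr' yy).
Qed.

Lemma sa_sq_annihilate a b x : star a = a -> star b = b -> a ** a = b ** b ->
  b ** x = 0 -> a ** x = 0.
Proof.
move=> sa sb ab bx; apply/eqP; rewrite -normr_eq0 -sqrf_eq0 -csnorm_star.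
rewrite starM sa csmulA -(csmulA (star x)) ab -csmulA -[b ** b ** x]csmulA.
by rewrite bx !csmul0r normr0.
Qed.

(** Here b is the absolute value of a. Let c = b - a, so that c^2 = 2 b c, and let e be the root of
    c^2. Then 2 b e and c^2 are positive with equal squares, hence equal, so b annihilates e - c; so
    do a, then c, then e. Thus (e - c)^2 = 0 and c = e is positive. *)
Lemma pos_abs_sub a b : star a = a -> pos b -> b ** b = a ** a ->
  a ** b = b ** a -> pos (b - a).
Proof.
move=> sa pb bb ab; set c := b - a.
have cs : star c = c by rewrite /c starB sa pb.1.
have bc : b ** c = c ** b by rewrite /c csmulBl csmulBr ab.
have cc : c ** c = 2 *: (b ** c).
  rewrite /c csmulBl !csmulBr -bb ab opprB.
  by rewrite scaler_nat mulr2n.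
have [e [pe ee ecomm _]] := pos_root (pos_sa_sq cs).
have be : b ** e = e ** b by apply: ecomm; rewrite csmulA bc -csmulA bc csmulA.
have ce : c ** e = e ** c by apply: ecomm; rewrite csmulA.
have bec : 2 *: (b ** e) = c ** c.
  apply: pos_sqrt_unique; first by apply: posZ => //; exact: posM.
    exact: pos_sa_sq.
  rewrite {2}cc [in RHS]cc !csmulZl !csmulZr !scalerA; congr (_ *: _).
  rewrite !csmulA -(csmulA b e b) -be -(csmulA b c b) -bc.
  by rewrite -!csmulA ee.
have bec0 : b ** (e - c) = 0.
  rewrite csmulBr; apply/eqP; rewrite subr_eq0; apply/eqP.
  by apply: (@scalerI _ _ 2); rewrite ?pnatr_eq0// bec cc.
have cec0 : c ** (e - c) = 0.
  by rewrite /c csmulBl bec0 (sa_sq_annihilate sa pb.1 (esym bb) bec0) subr0.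
have eec0 := sa_sq_annihilate pe.1 cs ee cec0.
have /eqP : e - c = 0.
  apply: sa_sq_eq0; first by rewrite starB pe.1 cs.
  by rewrite csmulBl eec0 cec0 subr0.
by rewrite subr_eq0 => /eqP <-.
Qed.

Lemma pos_parts a : star a = a ->
  exists p q, [/\ pos p, pos q, a = p - q & p ** q = 0].
Proof.
move=> sa; have [b [pb bb bcomm _]] := pos_root (pos_sa_sq sa).
have ab : a ** b = b ** a by apply: bcomm; rewrite csmulA.
have half0 : 0 <= 2^-1 :> R[i] by rewrite invr_ge0.
(* [b] is the absolute value of [a]. *)
exists (2^-1 *: (b + a)), (2^-1 *: (b - a)); split.
- apply: posZ => //; rewrite -[a]opprK; apply: pos_abs_sub => //.
  + by rewrite starN sa.
  + by rewrite csmulNl csmulNr opprK.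
  + by rewrite csmulNl csmulNr ab.
- by apply: posZ => //; exact: pos_abs_sub.
- by rewrite -scalerBr opprB addrA addrAC (addrC b a) addrK scale_half_addrr.
rewrite csmulZl csmulZr csmulDl !csmulBr bb ab addrA subrK.
by rewrite subrr !scaler0.
Qed.

Lemma cartesian a : exists h k,
  [/\ star h = h, star k = k, a = h + 'i *: k & h = 2^-1 *: (a + star a)].
Proof.
have half0 : 0 <= 2^-1 :> R[i] by rewrite invr_ge0.
exists (2^-1 *: (a + star a)), ('i *: (2^-1 *: (star a - a))); split => //.
- by rewrite starZ_ge0// starD starK addrC.
- by rewrite starZ starZ_ge0// starB starK conjCi scaleNr -scalerN -scalerN opprB.
rewrite scalerA -expr2 sqrCi scaleN1r -scalerBr opprB addrACA.
by rewrite subrr addr0 scale_half_addrr.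
Qed.

(** In the sum the cross terms of the Cartesian parts cancel, leaving 2 (h^2 + k^2). *)
Lemma pos_star_mul_sum a : pos (star a ** a + a ** star a).
Proof.
have [h [k [hs ks -> _]]] := cartesian a.
rewrite starD starZ conjCi hs ks scaleNr.
have -> : (h - 'i *: k) ** (h + 'i *: k) + (h + 'i *: k) ** (h - 'i *: k) =
    2 *: (h ** h + k ** k).
  rewrite !csmulDl !csmulDr !csmulNl !csmulNr !csmulZl !csmulZr scalerA.
  rewrite -expr2 sqrCi scaleN1r opprK scaler_nat mulr2n.
  rewrite [LHS]addrACA [X in X + _]addrACA subrr addr0 [X in _ + X]addrACA.
  by rewrite addNr add0r [RHS]addrACA.
by apply: posZ => //; apply: posD; exact: pos_sa_sq.
Qed.

(* Kelley-Vaught: cut down by the negative part of [star x ** x], [x] becomes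
   some [y] with [star y ** y <= 0 <= y ** star y], and the square root
   intertwining forces [y] to vanish. *)
Theorem pos_star_mul x : pos (star x ** x).
Proof.
have sa : star (star x ** x) = star x ** x by rewrite starM starK.
have [p [q [pp pq aE pq0]]] := pos_parts sa.
have qp0 : q ** p = 0 by rewrite -(starK (q ** p)) starM pp.1 pq.1 pq0 star0.
rewrite aE; suff -> : q = 0 by rewrite subr0.
set y := x ** q.
have yy : star y ** y = - (q ** q ** q).
  rewrite /y starM pq.1 csmulA -(csmulA q) aE csmulBr qp0 sub0r.
  by rewrite csmulNl.
have pqqq : pos (q ** q ** q).
  by apply: posM => //; [exact: pos_sa_sq pq.1 | rewrite csmulA].
have pyy : pos (y ** star y).
  have -> : y ** star y = (star y ** y + y ** star y) + q ** q ** q.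
    by rewrite yy addrAC addNr add0r.
  by apply: posD => //; exact: pos_star_mul_sum.
have yq : y ** (q ** q ** q) = - (y ** star y ** y).
  by rewrite -[q ** q ** q]opprK -yy csmulNr csmulA.
(* The sign in [yq] disappears when it is applied twice, so [y] intertwines the squares of two
   positive elements, hence the elements themselves. *)
have yq' : y ** (q ** q ** q) = y ** star y ** y.
  apply: pos_intertwine => //.
  by rewrite csmulA yq csmulNl -[y ** _ ** y ** _]csmulA yq csmulNr opprK !csmulA.
have Qy : y ** star y ** y = 0.
  have /eqP := yq'; rewrite yq eqr_oppLR -addr_eq0 -mulr2n -scaler_nat.
  by rewrite scaler_eq0 pnatr_eq0 => /eqP.
have yy0 : star y ** y = 0.
  apply: sa_sq_eq0; first by rewrite starM starK.
  by rewrite -csmulA (csmulA y) Qy csmul0r.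
apply: sa_sq_eq0; first exact: pq.1.
apply: sa_sq_eq0; first by rewrite starM pq.1.
by have /eqP := yy; rewrite yy0 eq_sym oppr_eq0 csmulA => /eqP ->; rewrite csmul0l.
Qed.

End Positivity.

(** * States *)

Section States.
Variables (R : realType) (A : cstarAlgType R).
Implicit Types (a b h k p q r x y : A) (c : R[i]) (B : set A) (phi : A -> R[i]).

Lemma csposE a : cspos a <-> pos a.
Proof.
split=> [[b ->]|/pos_root[r [[rs _] <- _ _]]]; first exact: pos_star_mul.
by exists r; rewrite rs.
Qed.

Lemma cssqrtE p : pos p -> cssqrt (p ** p) = p.
Proof.
move=> pp.
have /getPex[/csposE qp qq] :
    exists q, [set q | cspos q /\ q ** q = p ** p] q.
  by exists p; split=> //; apply/csposE.
exact: pos_sqrt_unique.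
Qed.

Lemma pos_norm_sub a : star a = a -> pos (`|a| *: csone - a).
Proof.
move=> sa; split; first by rewrite starB sa starZ_ge0// star1.
by exists `|a|; rewrite opprB addrCA subrr addr0.
Qed.

Lemma cs_one_subalgebra : cstar_subalgebra [set: A] /\ [set: A] csone.
Proof. by split=> //; split=> //; split=> //; exact: closedT. Qed.

Section Subalgebra.
Variable B : set A.
Hypotheses (subB : cstar_subalgebra B) (B1 : B csone).

Lemma subalgD a b : B a -> B b -> B (a + b).
Proof. by move=> Ba Bb; have [[_ _ H] _ _] := subB; rewrite -[a]scale1r; exact: H. Qed.

Lemma subalgZ c a : B a -> B (c *: a).
Proof. by move=> Ba; have [[_ B0 H] _ _] := subB; rewrite -[_ *: _]addr0; exact: H. Qed.

Lemma subalgB a b : B a -> B b -> B (a - b).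
Proof. by move=> Ba Bb; rewrite -scaleN1r; apply/subalgD/subalgZ. Qed.

(** The algebraic part of [state_on]; [state_onP] replaces the norm condition by the value 1 at the
    unit. *)
Definition positive_on phi :=
  (forall c a b, B a -> B b -> phi (c *: a + b) = c * phi a + phi b) /\
  (forall b, B b -> 0 <= phi (star b ** b)).

Variable phi : A -> R[i].
Hypothesis phip : positive_on phi.

Lemma positive_on0 : phi 0 = 0.
Proof.
have [[_ B0 _] _ _] := subB; have := phip.1 1 0 0 B0 B0.
by rewrite scale1r addr0 mul1r => h; apply: (addrI (phi 0)); rewrite addr0 -h.
Qed.

Lemma positive_onZ c a : B a -> phi (c *: a) = c * phi a.
Proof.
move=> Ba; have [[_ B0 _] _ _] := subB.
by rewrite -[c *: a]addr0 phip.1// positive_on0 addr0.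
Qed.

Lemma positive_onD a b : B a -> B b -> phi (a + b) = phi a + phi b.
Proof. by move=> Ba Bb; rewrite -{1}[a]scale1r phip.1// mul1r. Qed.

Lemma positive_onB a b : B a -> B b -> phi (a - b) = phi a - phi b.
Proof.
move=> Ba Bb; rewrite -scaleN1r positive_onD ?positive_onZ ?mulN1r//.
exact: subalgZ.
Qed.

(** Positivity in [A] of an element of [B] is witnessed inside [B], which contains its root. *)
Lemma positive_on_ge0 a : B a -> pos a -> 0 <= phi a.
Proof.
move=> Ba /pos_root[r [[rs _] ra _ rB]].
by rewrite -ra -{1}rs phip.2//; exact: rB.
Qed.

Lemma positive_on_sa_le h : B h -> star h = h -> phi h <= phi csone * `|h|.
Proof.
move=> Bh hs; have := positive_on_ge0 _ (pos_norm_sub hs).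
rewrite positive_onB ?positive_onZ// ?subr_ge0 1?mulrC; last exact: subalgZ.
by apply; apply: subalgB => //; exact: subalgZ.
Qed.

Lemma positive_on_sa_real h : B h -> star h = h -> phi h \is Num.real.
Proof.
move=> Bh hs.
(* A difference of two positive elements of [B]. *)
have -> : h = `|h| *: csone - (`|h| *: csone - h) by rewrite opprB addrC subrK.
have B1' : B (`|h| *: csone) by exact: subalgZ.
rewrite positive_onB//; last exact: subalgB.
rewrite positive_onZ// realB//; last first.
  by apply/ger0_real/positive_on_ge0; [exact: subalgB | exact: pos_norm_sub].
rewrite realM ?normr_real//; apply/ger0_real.
by rewrite -[csone]csmul1l -{1}star1 phip.2.
Qed.

Lemma subalg_cartesian a : B a -> exists h k,
  [/\ star h = h, star k = k, a = h + 'i *: k & B h /\ B k].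
Proof.
move=> Ba; have [h [k [hs ks ahk hE]]] := cartesian a.
exists h, k; split=> //; have Bh : B h.
  by rewrite hE; apply/subalgZ/subalgD => //; case: subB => _ _; apply.
split=> //; have -> : k = - 'i *: (a - h).
  by rewrite ahk addrC addKr scalerA mulNr -expr2 sqrCi opprK scale1r.
by apply/subalgZ/subalgB.
Qed.

Lemma positive_on_star a : B a -> phi (star a) = (phi a)^*%R.
Proof.
move=> /subalg_cartesian[h [k [hs ks -> [Bh Bk]]]].
rewrite starD starZ conjCi hs ks !positive_onD ?positive_onZ//; try exact: subalgZ.
rewrite rmorphD rmorphM/= conjCi !conj_Creal//; exact: positive_on_sa_real.
Qed.

(** A unimodular factor makes [phi a] real and nonnegative; it is then the value at a self-adjoint
    part, whose norm is no larger. *)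
Lemma positive_on_norm a : B a -> `|phi a| <= phi csone * `|a|.
Proof.
move=> Ba; have phi1 : 0 <= phi csone.
  by rewrite -[csone]csmul1l -{1}star1 phip.2.
have [->|z0] := eqVneq (phi a) 0; first by rewrite normr0 mulr_ge0.
pose c := `|phi a| / phi a; pose w := c *: a.
have Bw : B w by exact: subalgZ.
have Bsw : B (star w) by case: subB => _ _; apply.
have wE : phi w = `|phi a| by rewrite positive_onZ// /c divfK.
have wn : `|w| = `|a|.
  by rewrite normrZ normrM normfV normr_id divff ?normr_eq0// mul1r.
have -> : `|phi a| = phi (2^-1 *: (w + star w)).
  rewrite positive_onZ ?positive_onD//; last exact: subalgD.
  rewrite positive_on_star// wE conj_Creal ?normr_real//.
  by rewrite -mulr2n -(mulr_natl `|phi a| 2) mulKf// pnatr_eq0.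
apply: le_trans (positive_on_sa_le _ _) _.
- by apply/subalgZ/subalgD.
- by rewrite starZ_ge0 ?invr_ge0// starD starK addrC.
rewrite ler_wpM2l// normrZ ger0_norm ?invr_ge0// ler_pdivrMl ?ltr0n//.
by rewrite (le_trans (ler_normD _ _))// norm_star wn mulr_natl mulr2n.
Qed.

(** The variance, that is the value of [phi] at (h - phi h)^2, is nonnegative. *)
Lemma positive_on_sq_le h : B h -> star h = h -> phi csone = 1 ->
  phi h ^+ 2 <= phi (h ** h).
Proof.
move=> Bh hs phi1.
set t := phi h; have tr : t \is Num.real by exact: positive_on_sa_real.
have Bt : B (t *: csone) by exact: subalgZ.
have Bhh : B (h ** h) by case: subB => _ H _; exact: H.
have := phip.2 _ (subalgB Bh Bt).
rewrite starB hs starZ conj_Creal// star1.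
rewrite csmulBl !csmulBr csmulZl !csmulZr csmul1l csmul1r csmulZl csmul1l opprB.
rewrite -scaleNr.
have Bth : B (- t *: h) by exact: subalgZ.
have Btt : B (t *: (t *: csone)) by exact: subalgZ.
rewrite [phi _]positive_onD ?[phi (_ + _)]positive_onD//; try exact: subalgD.
by rewrite !positive_onZ// phi1 mulr1 -/t mulNr subrr addr0 subr_ge0 -expr2.
Qed.

End Subalgebra.

(** By [positive_on_norm], the supremum over the unit ball is attained at the unit. *)
Lemma state_onP B phi : cstar_subalgebra B -> B csone ->
  state_on B phi <-> positive_on B phi /\ phi csone = 1.
Proof.
move=> subB B1.
suff supE : positive_on B phi ->
    sup [set Normc.normc (phi b) | b in [set b | B b /\ `|b| <= 1]] =
    complex.Re (phi csone).
  split=> [[lin p s1]|[[lin p] phi1]].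
    split=> //; have := supE (conj lin p); rewrite s1.
    have : 0 <= phi csone by rewrite -[csone]csmul1l -{1}star1 p.
    by move=> /ger0_Im; case: (phi csone) => x y /= -> <-.
  by split=> //; rewrite supE// phi1.
move=> pp; have phi1 : 0 <= phi csone by rewrite -[csone]csmul1l -{1}star1 pp.2.
have [t tE] : exists t : R, phi csone = t%:C%C.
  by have /complex_realP[t] := ger0_real phi1; exists t.
have t0 : 0 <= t by rewrite -ler0c -tE.
rewrite tE /=; set S := [set _ | _ in _].
have St : S t.
  exists csone; first by split=> //; exact: norm_csone.
  by rewrite tE; apply: complexI; rewrite -[LHS]/(`|t%:C%C|) ger0_norm ?ler0c.
have ubS : ubound S t.
  move=> _ [b [Bb b1] <-]; rewrite -lecR -[X in X <= _]/(`|phi b|).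
  rewrite (le_trans (positive_on_norm subB B1 pp Bb))// tE ler_piMr// ler0c//.
apply: le_anti; apply/andP; split; first by apply: ge_sup => //; exists t.
by apply: ub_le_sup => //; exists t.
Qed.

End States.

(** * The Hahn-Banach theorem *)

Section HahnBanach.
Variables (R : realType) (V : lmodType R) (p : V -> R).
Hypotheses (pD : forall x y, p (x + y) <= p x + p y)
  (pZ : forall (t : R) x, 0 <= t -> p (t *: x) = t * p x).
Implicit Types (G X : set (V * R)) (x y : V) (r s t : R).

(* graph of a functional on a subspace; that it is single-valued is a
   consequence of the domination by [p], see [dominated_graph_fun] *)
Definition dominated_graph G :=
  [/\ G (0, 0),
      forall t x y r s, G (x, r) -> G (y, s) -> G (t *: x + y, t * r + s)
    & forall x r, G (x, r) -> r <= p x].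

Lemma dominated_graph_fun G x r s :
  dominated_graph G -> G (x, r) -> G (x, s) -> r = s.
Proof.
move=> [_ Glin Gp].
have p0 : p 0 = 0 by rewrite -(scale0r 0) pZ// mul0r.
suff le u v : G (x, u) -> G (x, v) -> v <= u.
  by move=> xr xs; apply: le_anti; rewrite !le.
move=> xu xv; have := Gp _ _ (Glin (-1) _ _ _ _ xu xv).
by rewrite scaleN1r addNr p0 mulN1r addrC subr_le0.
Qed.

(** Subadditivity puts every lower bound [r - p (x - x0)] for the value at [x0] below every upper
    bound [p (y + x0) - s]; the supremum of the lower bounds is chosen. The lower bounds serve the
    negative multiples of [x0], the upper bounds the positive ones. *)
Lemma dominated_graph_extend G x0 : dominated_graph G -> exists c,
  dominated_graph
    [set z | exists t y r, G (y, r) /\ z = (t *: x0 + y, t * c + r)].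
Proof.
move=> [G0 Glin Gp].
have GZ t x r : G (x, r) -> G (t *: x, t * r).
  by move=> xr; have := Glin t _ _ _ _ xr G0; rewrite !addr0.
pose S := [set s | exists x r, G (x, r) /\ s = r - p (x - x0)].
have ubS y s : G (y, s) -> ubound S (p (y + x0) - s).
  move=> ys _ [x [r [xr ->]]].
  rewrite lerBlDr addrAC lerBrDr.
  have /Gp := Glin 1 _ _ _ _ xr ys; rewrite scale1r mul1r.
  move=> /le_trans; apply.
  have -> : x + y = (y + x0) + (x - x0) by rewrite addrACA [y + x]addrC subrr addr0.
  exact: pD.
have S0 : S !=set0 by exists (0 - p (0 - x0)), 0, 0.
have hubS : has_ubound S by exists (p (0 + x0) - 0); exact: ubS.
exists (sup S); split.
- by exists 0, 0, 0; rewrite scale0r mul0r !addr0.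
- move=> t _ _ _ _ [u [x [r [xr [-> ->]]]]] [v [y [s [ys [-> ->]]]]].
  exists (t * u + v), (t *: x + y), (t * r + s); split; first exact: Glin.
  congr (_, _); last by ring.
  by rewrite scalerDr scalerDl scalerA addrACA.
move=> _ _ [t [y [r [yr [-> ->]]]]].
have [t0|t0|->] := ltgtP t 0; last by rewrite scale0r mul0r !add0r; exact: Gp.
- have nt0 : 0 < - t by rewrite oppr_gt0.
  have : (- t)^-1 * r - p ((- t)^-1 *: y - x0) <= sup S.
    apply: ub_le_sup => //; exists ((- t)^-1 *: y), ((- t)^-1 * r).
    by split=> //; exact: GZ.
  rewrite -(ler_pM2l nt0) mulrBr mulrA mulfV ?gt_eqF// mul1r -pZ ?(ltW nt0)//.
  rewrite scalerBr scalerA mulfV ?gt_eqF// scale1r scaleNr opprK (addrC y).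
  by rewrite mulNr; lra.
have : sup S <= p (t^-1 *: y + x0) - t^-1 * r.
  by apply: ge_sup => //; apply: ubS; exact: GZ.
rewrite -(ler_pM2l t0) mulrBr mulrA mulfV ?gt_eqF// mul1r -pZ ?(ltW t0)//.
by rewrite scalerDr scalerA mulfV ?gt_eqF// scale1r (addrC y); lra.
Qed.

Theorem hahn_banach G : dominated_graph G -> exists g : V -> R,
  [/\ forall t x y, g (t *: x + y) = t * g x + g y,
      forall x, g x <= p x & forall x r, G (x, r) -> g x = r].
Proof.
move=> Gd.
(* Zorn's lemma is applied to the sets added to [G], so that the empty chain, whose union is empty,
   is covered too. *)
have [F FP Ftot|X [Xd Xmax]] :=
    @Zorn_bigcup _ [set X | dominated_graph (G `|` X)].
  rewrite /=; set U := \bigcup_(_ in _) _.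
  have chain z z' : (G `|` U) z -> (G `|` U) z' -> exists Y,
      [/\ dominated_graph Y, Y z, Y z' & Y `<=` G `|` U].
    have sub X : F X -> G `|` X `<=` G `|` U.
      by move=> FX w [Gw|Xw]; [left|right; exists X].
    move=> [Gz|[X FX Xz]] [Gz'|[X' FX' Xz']].
    - by exists G; split=> // w; left.
    - by exists (G `|` X'); split; [exact: FP|left|right|exact: sub].
    - by exists (G `|` X); split; [exact: FP|right|left|exact: sub].
    - have [XX'|XX'] := Ftot _ _ FX FX'.
        exists (G `|` X'); split; [exact: FP| |by right|exact: sub].
        by right; exact: XX'.
      exists (G `|` X); split; [exact: FP|by right| |exact: sub].
      by right; exact: XX'.
  split; first by left; case: Gd.
    move=> t x y r s xr ys; have [Y [[_ Ylin _] Yx Yy]] := chain _ _ xr ys.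
    by apply; exact: Ylin.
  by move=> x r xr; have [Y [[_ _ Yp] Yx _ _]] := chain _ _ xr xr; exact: Yp.
set H := G `|` X in Xd.
have Htot x : exists r, H (x, r).
  apply: contrapT => Hx; have [c] := dominated_graph_extend x Xd.
  set H' := [set _ | _] => H'd.
  have HH' : H `<=` H'.
    by move=> [y s] ys; exists 0, y, s; rewrite scale0r mul0r !add0r.
  have H'x : H' (x, c).
    by exists 1, 0, 0; rewrite scale1r mul1r !addr0; split=> //; case: Xd.
  apply: (Xmax H'); last first.
    by rewrite /= (setUidPr _ _).2// => z Gz; apply: HH'; left.
  split=> [z Xz|H'X]; first by apply: HH'; right.
  by apply: Hx; exists c; right; exact: H'X.
pose g x := get [set r | H (x, r)].
have Hg x : H (x, g x) by exact: (getPex (Htot x)).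
have [_ Hlin Hp] := Xd.
exists g; split=> [t x y|x|x r xr].
- by apply: (dominated_graph_fun Xd (Hg _)); exact: (Hlin _ _ _ _ _ (Hg x) (Hg y)).
- exact: (Hp _ _ (Hg x)).
- by apply: (dominated_graph_fun Xd (Hg x)); left.
Qed.

End HahnBanach.

(** * Extension of states *)

(** An alias to carry the real vector space structure that Hahn-Banach requires, beside the complex
    one. *)
Definition realified (R : realType) (V : lmodType (Cfield R)) : Type := V.

Section Realified.
Variables (R : realType) (V : lmodType (Cfield R)).

HB.instance Definition _ := GRing.Zmodule.copy (realified V) V.

Definition real_scale (t : R) (x : realified V) : realified V :=
  (t%:C%C : Cfield R) *: (x : V).

Fact real_scalerA s t x : real_scale s (real_scale t x) = real_scale (s * t) x.
Proof. by rewrite /real_scale scalerA rmorphM. Qed.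

Fact real_scale1r : left_id 1 real_scale.
Proof. by move=> x; rewrite /real_scale rmorph1 scale1r. Qed.

Fact real_scalerDr : right_distributive real_scale +%R.
Proof. by move=> t x y; exact: scalerDr. Qed.

Fact real_scalerDl x : {morph real_scale^~ x : s t / s + t}.
Proof. by move=> s t; rewrite /real_scale rmorphD; exact: scalerDl. Qed.

HB.instance Definition _ := GRing.Zmodule_isLmodule.Build R (realified V)
  real_scalerA real_scale1r real_scalerDr real_scalerDl.

End Realified.

Section StateExtension.
Variables (R : realType) (A : cstarAlgType R).
Implicit Types (a b x y : A) (c : R[i]) (r s t : R).

Definition real_norm (x : A) : R := complex.Re `|x|.

Lemma real_normE x : (real_norm x)%:C%C = `|x|.
Proof. by rewrite RRe_real// normr_real. Qed.

(** Sublinear over the reals and zero on skew-adjoint elements, so that real functionals dominated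
    by it vanish there too. *)
Definition sa_norm (x : A) : R := real_norm (2^-1 *: (x + star x)).

Lemma sa_norm_le x : (sa_norm x)%:C%C <= `|x|.
Proof.
rewrite real_normE normrZ ger0_norm ?invr_ge0// ler_pdivrMl ?ltr0n//.
by rewrite (le_trans (ler_normD _ _))// norm_star mulr_natl mulr2n.
Qed.

Lemma sa_norm_sa x : star x = x -> (sa_norm x)%:C%C = `|x|.
Proof. by move=> xs; rewrite real_normE xs scale_half_addrr. Qed.

Lemma sa_normD x y : sa_norm (x + y) <= sa_norm x + sa_norm y.
Proof.
by rewrite -lecR rmorphD/= !real_normE starD addrACA scalerDr ler_normD.
Qed.

Lemma sa_normZ t x : 0 <= t -> sa_norm (t%:C%C *: x) = t * sa_norm x.
Proof.
move=> t0; apply: complexI; rewrite rmorphM/= !real_normE.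
rewrite starZ_ge0 ?ler0c// -scalerDr scalerA mulrC -scalerA normrZ.
by rewrite ger0_norm// ler0c.
Qed.

Lemma hahn_banach_sa (G : set (realified A * R)) :
  dominated_graph (@sa_norm : realified A -> R) G -> exists g : A -> R,
  [/\ forall t x y, g (t%:C%C *: x + y) = t * g x + g y,
      forall x, g x <= sa_norm x & forall x r, G (x, r) -> g x = r].
Proof.
move=> Gd; have [||g [glin gle gG]] := @hahn_banach _ (realified A) sa_norm _ _ G Gd.
- exact: sa_normD.
- exact: sa_normZ.
- by exists g; split=> //; exact: glin.
Qed.

(** The usual complexification g x - i g (i x). It is real on self-adjoint elements because [g]
    vanishes on skew-adjoint ones. *)
Lemma state_of_real (g : A -> R) :
  (forall t x y, g (t%:C%C *: x + y) = t * g x + g y) ->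
  (forall x, g x <= sa_norm x) -> g csone = 1 ->
  exists2 phi : A -> R[i], state phi & forall x, complex.Re (phi x) = g x.
Proof.
move=> glin gle g1.
have g0 : g 0 = 0.
  have := glin 1 0 0; rewrite scale1r addr0 mul1r => h.
  by apply: (addrI (g 0)); rewrite addr0 -h.
have gD x y : g (x + y) = g x + g y.
  by have := glin 1 x y; rewrite scale1r mul1r.
have gZ t x : g (t%:C%C *: x) = t * g x.
  by have := glin t x 0; rewrite !addr0 g0 addr0.
have gN x : g (- x) = - g x.
  by rewrite -scaleN1r -(rmorph1 (real_complex R)) -rmorphN gZ mulN1r.
have gsa x : star x = x -> g ('i *: x) = 0.
  move=> xs; have isk : sa_norm ('i *: x) = 0 /\ sa_norm (- ('i *: x)) = 0.
    rewrite /sa_norm starN starZ conjCi xs scaleNr opprK subrr addNr.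
    by rewrite scaler0 /real_norm normr0.
  apply/le_anti/andP; split; first by rewrite -isk.1 gle.
  by rewrite -oppr_le0 -gN -isk.2 gle.
have cE c x : c *: x = (complex.Re c)%:C%C *: x + (complex.Im c)%:C%C *: ('i *: x).
  rewrite scalerA -scalerDl; congr (_ *: _).
  by rewrite {1}[c]complexE mulrC.
exists (fun x => Complex (g x) (- g ('i *: x))) => //.
apply/state_onP; rewrite /=; try by case: (cs_one_subalgebra A).
split; last by rewrite g1 gsa ?star1// oppr0.
split=> [c x y _ _|x _].
  have gc z : g (c *: z) = complex.Re c * g z + complex.Im c * g ('i *: z).
    by rewrite {1}cE gD !gZ.
  have ii : 'i *: ('i *: x) = - x by rewrite scalerA -expr2 sqrCi scaleN1r.
  rewrite scalerDr !gD gc scalerA ['i * c]mulrC -scalerA gc ii gN.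
  case: c {gc} => u v /=; apply/eqP; rewrite eq_complex /=.
  by apply/andP; split; apply/eqP; ring.
have pxx := pos_star_mul x; rewrite (gsa _ pxx.1) oppr0 lecE /= eqxx /=.
have [xs [t tx]] := pxx.
have t0 : 0 <= t := le_trans (normr_ge0 _) tx.
have /complex_realP[r rE] : t \is Num.real by exact: ger0_real.
(* With r the radius witnessing positivity, r - g (star x ** x) is at most r. *)
have := gle (r%:C%C *: csone - star x ** x).
rewrite gD gZ g1 mulr1 gN.
have : (sa_norm (r%:C%C *: csone - star x ** x))%:C%C <= r%:C%C.
  by rewrite sa_norm_sa -?rE// starB xs starZ_ge0 ?star1.
by rewrite lecR; lra.
Qed.

Lemma norm_csone_eq1 : (csone : A) != 0 -> `|csone : A| = 1.
Proof.
move=> A0; apply: (mulIf (x := `|csone : A|)); rewrite ?normr_eq0// mul1r.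
by rewrite -expr2 -csnorm_star star1 csmul1r.
Qed.

Lemma pos1 : pos (csone : A).
Proof. by rewrite -[csone]csmul1r -{1}star1; exact: pos_star_mul. Qed.

(** With N the norm of a + 1, the element (N - 1) - a is positive, and N >= 1, so [pos_le_norm]
    bounds the norm of a by N - 1. *)
Lemma pos_norm_add1 a : (csone : A) != 0 -> pos a -> `|a + csone| = `|a| + 1.
Proof.
move=> A0 pa; apply: le_anti; rewrite (le_trans (ler_normD _ _)) ?lerD2l ?norm_csone//=.
have sa1 : star (a + csone) = a + csone by rewrite starD pa.1 star1.
have pN := pos_norm_sub sa1; set N := `|a + csone| in pN *.
have N1 : 1 <= N.
  rewrite -norm_csone_eq1// -[leRHS](ger0_norm (normr_ge0 (a + csone))).
  apply: pos_le_norm pos1 _.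
  have -> : N *: csone - csone = (N *: csone - (a + csone)) + a.
    by rewrite opprD addrA addrAC subrK.
  exact: posD.
have := @pos_le_norm _ _ a (N - 1) pa.
rewrite ger0_norm ?subr_ge0// lerBrDr; apply.
by rewrite scalerBl scale1r -addrA -opprD addrC [csone + a]addrC addrC.
Qed.

(** The functional is prescribed on the line through a + 1 only: its values at a and 1 are at most
    |a| and 1 and add up to |a| + 1, so both bounds are attained. *)
Lemma pos_norming_state a : (csone : A) != 0 -> pos a ->
  exists2 psi : A -> R[i], state psi & psi a = `|a|.
Proof.
move=> A0 pa; have sa1 : star (a + csone) = a + csone by rewrite starD pa.1 star1.
have aN : real_norm (a + csone) = real_norm a + 1.
  by apply: complexI; rewrite rmorphD /= !real_normE pos_norm_add1.
pose G : set (realified A * R) :=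
  [set z | exists t : R, z = (t%:C%C *: (a + csone), t * real_norm (a + csone))].
have [|g [glin gle gG]] := @hahn_banach_sa G.
  split.
  - by exists 0; rewrite scale0r mul0r.
  - move=> t _ _ _ _ [u [-> ->]] [v [-> ->]]; exists (t * u + v).
    congr (_, _); last by ring.
    rewrite rmorphD rmorphM/= scalerDl -scalerA; reflexivity.
  - move=> _ _ [t [-> ->]]; rewrite -lecR sa_norm_sa; last first.
      by rewrite starZ conj_Creal ?sa1//; apply/complex_realP; exists t.
    rewrite normrZ rmorphM/= real_normE ler_wpM2r//.
    rewrite (_ : `|t%:C%C| = (`|t|)%:C%C) ?lecR ?ler_norm//.
    by rewrite normc_def /= expr0n addr0 sqrtr_sqr.
have g_add : g (a + csone) = real_norm a + 1.
  by apply: gG; exists 1; rewrite scale1r mul1r aN.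
have gD : g (a + csone) = g a + g csone.
  by have := glin 1 a csone; rewrite scale1r mul1r.
have ga : g a <= real_norm a.
  by rewrite (le_trans (gle a))// -lecR (le_trans (sa_norm_le a))// real_normE.
have g1 : g csone <= 1.
  by rewrite (le_trans (gle csone))// -lecR (le_trans (sa_norm_le csone))// norm_csone.
have {}g1 : g csone = 1 by lra.
have {}ga : g a = real_norm a by lra.
have [psi psis psig] := state_of_real glin gle g1.
exists psi => //; rewrite -real_normE -ga -psig RRe_real//.
have [subA A1] := cs_one_subalgebra A.
have /state_onP[//|//|psip _] := psis.
exact: (positive_on_sa_real subA A1 psip _ pa.1).
Qed.

End StateExtension.

(** * Module independence *)

Section Extension.
Variables (R : realType) (A : cstarAlgType R).
Implicit Types (a b c x : A) (B : set A) (phi psi chi : A -> R[i]).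

Lemma state_on_subset B B' phi : cstar_subalgebra B -> B csone ->
  cstar_subalgebra B' -> B' csone -> B `<=` B' -> state_on B' phi -> state_on B phi.
Proof.
move=> subB B1 subB' B'1 BB' /state_onP[//|//|[lin p] phi1].
apply/state_onP => //; split=> //; split=> [c a b Ba Bb|b Bb].
  by apply: lin; exact: BB'.
exact/p/BB'.
Qed.

(** Since c commutes with |c| - c, the square of c lies below |c| c, where |c| is the norm. *)
Lemma positive_on_sq_eq0 B phi c : cstar_subalgebra B -> B csone ->
  positive_on B phi -> B c -> pos c -> phi c = 0 -> phi (c ** c) = 0.
Proof.
move=> subB B1 phip Bc pc c0.
have Bcc : B (c ** c) by case: subB => _ H _; exact: H.
have Bnc : B (`|c| *: c) by exact: subalgZ.
apply: le_anti; apply/andP; split; last first.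
  by rewrite -{1}pc.1 phip.2.
have : pos (c ** (`|c| *: csone - c)).
  apply: posM => //; first exact: pos_norm_sub pc.1.
  by rewrite csmulBr csmulBl csmulZl csmulZr csmul1l csmul1r.
rewrite csmulBr csmulZr csmul1r.
move=> /(positive_on_ge0 subB B1 phip)-/(_ (subalgB subB Bnc Bcc)).
by rewrite (positive_onB subB phip)// (positive_onZ subB phip)// c0 mulr0 subr_ge0.
Qed.

Lemma Re_positive_on B phi a : cstar_subalgebra B -> B csone ->
  positive_on B phi -> B a ->
  (complex.Re (phi a))%:C%C = phi (2^-1 *: (a + star a)).
Proof.
move=> subB B1 phip Ba; have Bs : B (star a) by case: subB => _ _; apply.
rewrite (positive_onZ subB phip) ?(positive_onD phip)//; last exact: subalgD.
rewrite (positive_on_star subB B1 phip)//.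
by rewrite -[(phi a)^*%R]/(conjc (phi a)) addcJ mulKf// pnatr_eq0.
Qed.

Lemma positive_on_eq B phi psi : cstar_subalgebra B ->
  positive_on B phi -> positive_on B psi ->
  (forall b, B b -> complex.Re (phi b) = complex.Re (psi b)) ->
  forall b, B b -> phi b = psi b.
Proof.
move=> subB phip psip RE b Bb.
have ReiM (z : R[i]) : complex.Re ('i * z) = - complex.Im z.
  by rewrite -complexiE mulrC ReiNIm.
have := RE _ (subalgZ subB 'i Bb).
rewrite (positive_onZ subB phip)// (positive_onZ subB psip)//.
rewrite !ReiM => /oppr_inj IE.
by apply/eqP; rewrite eq_complex RE// IE !eqxx.
Qed.

(* A state [psi] taking its maximum at [a] and a functional [phi] dominated as
   in module independence agree at [a], by the vanishing of [psi] on the square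
   of the distance to the maximum. *)
Lemma state_le_dominated B M a psi phi chi : cstar_subalgebra B -> B csone ->
  B a -> star a = a -> state psi -> state phi -> state_on B chi ->
  psi (a + `|a| *: csone) = `|a + `|a| *: csone| ->
  (forall c, B c -> pos c -> phi c <= M * sqrtC (psi (c ** c))) ->
  chi a <= phi a.
Proof.
move=> subB B1 Ba sa psis phis chis psia dom.
have [subA A1] := cs_one_subalgebra A.
have /state_onP[//|//|psip psi1] := psis.
have /state_onP[//|//|phip phi1] := phis.
have /state_onP[//|//|chip chi1] := chis.
set d := a + _ in psia.
have Bn : B (`|a| *: csone) by exact: subalgZ.
have Bd : B d by exact: subalgD.
have sd : star d = d by rewrite /d starD sa starZ_ge0// star1.
pose c := `|d| *: csone - d.
have Bnd : B (`|d| *: csone) by exact: subalgZ.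
have Bc : B c by exact: subalgB.
have pc : pos c by exact: pos_norm_sub.
have c0 : psi c = 0.
  rewrite (positive_onB subA psip)// (positive_onZ subA psip)//.
  by rewrite psi1 mulr1 psia subrr.
(* The right-hand side vanishes, so |d| <= phi d, while chi d <= |d|. *)
have := dom c Bc pc.
rewrite (positive_on_sq_eq0 subA A1 psip _ pc c0)// sqrtC0 mulr0.
rewrite (positive_onB subA phip)// (positive_onZ subA phip)// phi1 mulr1.
rewrite subr_le0 => /(le_trans (_ : chi d <= `|d|)).
have -> : chi d <= `|d|.
  by rewrite (le_trans (positive_on_sa_le subB B1 chip Bd sd))// chi1 mul1r.
move=> /(_ isT); rewrite /d (positive_onD phip)// (positive_onD chip)//.
rewrite (positive_onZ subA phip)// (positive_onZ subB chip)// phi1 chi1.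
by rewrite lerD2r.
Qed.

(** Hahn-Banach on B1 + B2 for the sum of the real parts. Passing to self-adjoint parts turns the
    hypothesis into domination by [sa_norm], which also makes the sum independent of the
    decomposition. *)
Lemma state_joint_extension B1 B2 phi1 phi2 :
  cstar_subalgebra B1 -> B1 csone -> cstar_subalgebra B2 -> B2 csone ->
  state_on B1 phi1 -> state_on B2 phi2 ->
  (forall a b, B1 a -> B2 b -> star a = a -> star b = b ->
    phi1 a + phi2 b <= `|a + b|) ->
  exists2 phi, state phi &
    (forall b, B1 b -> phi b = phi1 b) /\ (forall b, B2 b -> phi b = phi2 b).
Proof.
move=> sub1 o1 sub2 o2 phis1 phis2 dom.
have [subA A1] := cs_one_subalgebra A.
have /state_onP[//|//|phip1 phi11] := phis1.
have /state_onP[//|//|phip2 phi21] := phis2.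
have B10 : B1 0 by case: sub1 => -[].
have B20 : B2 0 by case: sub2 => -[].
have p10 := positive_on0 sub1 phip1; have p20 := positive_on0 sub2 phip2.
pose G : set (realified A * R) := [set z | exists a b, [/\ B1 a, B2 b &
  z = (a + b, complex.Re (phi1 a) + complex.Re (phi2 b))]].
have ReZD (u v : R[i]) (t : R) :
    complex.Re (t%:C%C * u + v) = t * complex.Re u + complex.Re v.
  by case: u => ? ?; case: v => ? ? /=; rewrite mul0r subr0.
have [|g [glin gle gG]] := @hahn_banach_sa _ A G.
  split.
  - by exists 0, 0; split; rewrite // p10 p20 /= !addr0.
  - move=> t _ _ _ _ [a [b [Ba Bb [-> ->]]]] [a' [b' [Ba' Bb' [-> ->]]]].
    exists (t%:C%C *: a + a'), (t%:C%C *: b + b'); split.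
    + by apply: (subalgD sub1) => //; exact: subalgZ.
    + by apply: (subalgD sub2) => //; exact: subalgZ.
    + congr (_, _); last by rewrite phip1.1// phip2.1// !ReZD; ring.
      by rewrite addrACA -scalerDr.
  - move=> _ _ [a [b [Ba Bb [-> ->]]]].
    rewrite -lecR rmorphD/= (Re_positive_on sub1 o1 phip1)// (Re_positive_on sub2 o2 phip2)//.
    have Bsa : B1 (star a) by case: sub1 => _ _; apply.
    have Bsb : B2 (star b) by case: sub2 => _ _; apply.
    rewrite (le_trans (dom _ _ _ _ _ _))//.
    + by apply/(subalgZ sub1)/(subalgD sub1).
    + by apply/(subalgZ sub2)/(subalgD sub2).
    + by rewrite starZ_ge0 ?invr_ge0// starD starK addrC.
    + by rewrite starZ_ge0 ?invr_ge0// starD starK addrC.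
    by rewrite real_normE -scalerDr addrACA -starD.
have g1 : g csone = 1.
  by apply: gG; exists csone, 0; split; rewrite // phi11 p20 /= !addr0.
have [phi phis phig] := state_of_real glin gle g1.
have /state_onP[//|//|phip _] := phis.
exists phi => //; split; apply: positive_on_eq => //.
- by split=> *; [exact: phip.1 | exact: phip.2].
- move=> b Bb; rewrite phig; apply: gG; exists b, 0.
  by rewrite p20 /= !addr0.
- by split=> *; [exact: phip.1 | exact: phip.2].
- move=> b Bb; rewrite phig; apply: gG; exists 0, b.
  by rewrite p10 /= !add0r.
Qed.

End Extension.

(** * Transport of states and independence along an isometric isomorphism *)

Section Transport.
Variables (R : realType) (A A' : cstarAlgType R) (f : A -> A') (f' : A' -> A).
Hypotheses (fK : cancel f f') (f'K : cancel f' f).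
Hypotheses (flin : forall (c : R[i]) a b, f (c *: a + b) = c *: f a + f b)
  (fstar : forall b, f (star b ** b) = star (f b) ** f b)
  (fnorm : forall b, `|f b| = `|b|).

(** A state sees the algebra through its linear structure, the products [star b ** b] and the norm,
    all preserved by [f]. *)
Lemma state_on_image (B : set A) (phi : A' -> R[i]) :
  state_on (f @` B) phi <-> state_on B (phi \o f).
Proof.
have supE : [set Normc.normc (phi b) | b in [set b | (f @` B) b /\ `|b| <= 1]] =
    [set Normc.normc ((phi \o f) b) | b in [set b | B b /\ `|b| <= 1]].
  apply/seteqP; split=> _ [b [Bb b1] <-].
    by case: Bb b1 => a Ba <-; rewrite fnorm => a1; exists a.
  by exists (f b) => //; split; [exists b | rewrite fnorm].
rewrite /state_on supE; split=> -[lin p s1]; split=> //.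
- move=> c a b Ba Bb /=; rewrite flin; apply: lin; [by exists a|by exists b].
- by move=> b Bb /=; rewrite fstar; apply: p; exists b.
- move=> c _ _ [a Ba <-] [b Bb <-]; rewrite -flin; exact: lin.
- by move=> _ [b Bb <-]; rewrite -fstar; exact: p.
Qed.

Lemma cstar_independent_image (B1 B2 : set A) :
  cstar_independent (f @` B1) (f @` B2) <-> cstar_independent B1 B2.
Proof.
have fT : f @` setT = setT.
  by apply/seteqP; split=> // b _; exists (f' b).
split=> ind phi1 phi2.
  have eqf (phi : A -> R[i]) : phi = (phi \o f') \o f.
    by apply/funext => a /=; rewrite fK.
  rewrite {1}(eqf phi1) {1}(eqf phi2) => /state_on_image s1 /state_on_image s2.
  have [phi phis [e1 e2]] := ind _ _ s1 s2.
  exists (phi \o f); first by apply/state_on_image; rewrite fT.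
  split=> b Bb /=; [rewrite e1|rewrite e2]; rewrite /= ?fK//; by exists b.
move=> /state_on_image s1 /state_on_image s2.
have [phi phis [e1 e2]] := ind _ _ s1 s2.
exists (phi \o f').
  rewrite /state -fT; apply/state_on_image.
  by rewrite (_ : _ \o f = phi)//; apply/funext => a /=; rewrite fK.
by split=> _ [b Bb <-]; rewrite /= fK; [exact: e1 | exact: e2].
Qed.

End Transport.

(** * The subalgebra spanned by the inner products of a ternary subspace *)

Section TernarySubspace.
Variables (R : realType) (A : cstarAlgType R) (E : hilbertModType A).
Variables (z0 : E) (hz0 : inner z0 z0 = csone) (F : set E).
Hypotheses (Ft : ternary F) (Fz0 : F z0).

Lemma inner_span_inner x y : F x -> F y -> inner_span F (inner x y).
Proof. by move=> Fx Fy B [_]; apply; exists x => //; exists y. Qed.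

(** Replaces the closed linear span by a pointwise condition, from which closure under products and
    adjoints follows without approximation. *)
Lemma inner_spanE a : inner_span F a <-> F (z0 <* a).
Proof.
split=> [|Fa]; first exact: Ft.2.
by rewrite -(inner_z0 hz0 a); exact: inner_span_inner.
Qed.

Lemma inner_span_one : inner_span F csone.
Proof. by rewrite -hz0; exact: inner_span_inner. Qed.

Lemma inner_span_subalgebra : cstar_subalgebra (inner_span F).
Proof.
split; first split.
- by apply: closed_bigI => B [[]].
- by move=> B [[]].
- by move=> c x y Bx By B BF; have [[_ _ lin] _] := BF; apply: lin; [exact: Bx|exact: By].
- move=> a b /inner_spanE Fa Bb; apply/inner_spanE; rewrite ractM.
  exact: Ft.2.
- move=> a /inner_spanE Fa.
  by rewrite -(inner_z0 hz0 a) star_inner; exact: inner_span_inner.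
Qed.

(** With [inner_spanE], every positive element of the subalgebra is |x| for some x in [F]. *)
Lemma hmabs_z0 c : pos c -> hmabs (z0 <* c) = c.
Proof.
by move=> pc; rewrite /hmabs innerMl innerMr hz0 csmul1l pc.1 cssqrtE.
Qed.

Lemma hmabs_span x : F x -> inner_span F (hmabs x) /\ pos (hmabs x).
Proof.
move=> Fx; have /csposE/pos_root[r [rp rr _ rB]] := inner_pos x.
rewrite /hmabs -rr cssqrtE//; split=> //; apply: (rB (inner_span F)).
- exact: inner_span_subalgebra.
- exact: inner_span_one.
- exact: inner_span_inner.
Qed.

(** Each x has the same class as z0 <z0, x>. *)
Lemma brk_image : brk hz0 @` F = (fun a => brk hz0 (z0 <* a)) @` inner_span F.
Proof.
apply/seteqP; split=> _ [x Fx <-].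
  by exists (inner z0 x); [exact: inner_span_inner | exact: brk_z0].
by exists (z0 <* x) => //; exact/inner_spanE.
Qed.

End TernarySubspace.

Theorem theorem4p1 (R : realType) (A : cstarAlgType R) (E : hilbertModType A)
    (E1 E2 : set E) (z0 : E)
    (E1_ternary : ternary E1) (E2_ternary : ternary E2)
    (E1z0 : E1 z0) (E2z0 : E2 z0) (hz0 : inner z0 z0 = csone) :
  module_independent E1 E2 <->
  cstar_independent (brk hz0 @` E1)%classic (brk hz0 @` E2)%classic.
Proof.
rewrite !brk_image//.
set f := fun a => brk hz0 (z0 <* a).
pose f' (u : bracket hz0) := inner z0 (brk_repr u).
have fK : cancel f f' by move=> a; rewrite /f' inner_brk_repr inner_z0.
have f'K : cancel f' f.
  by elim/brkW => x; rewrite /f /f' inner_brk_repr; exact: brk_z0.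
have flin (c : R[i]) a b : f (c *: a + b) = c *: f a + f b.
  by rewrite /f ractDr ractZr brkD brkZ.
have fstar b : f (star b ** b) = star (f b) ** f b.
  rewrite [RHS](_ : _ = brk_mul (brk_star (f b)) (f b))// brk_starE brk_mulE.
  apply/brk_eqP.
  rewrite !innerMr !innerMl hz0 !csmul1l.
  by rewrite csmul1r.
have fnorm b : `|f b| = `|b| by rewrite /f brk_normrE inner_z0.
rewrite (cstar_independent_image fK f'K flin fstar fnorm).
have sub1 := inner_span_subalgebra hz0 E1_ternary E1z0.
have sub2 := inner_span_subalgebra hz0 E2_ternary E2z0.
have o1 := inner_span_one hz0 E1z0; have o2 := inner_span_one hz0 E2z0.
have [subA A1] := cs_one_subalgebra A.
split=> [[m [M [m0 M0 ind]]] phi1 phi2 phis1 phis2|ind].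
  apply: state_joint_extension => // a b Ba Bb sa sb.
  (* The zero algebra carries no state, whereas [phi1] is one. *)
  have A0 : (csone : A) != 0.
    have /state_onP[//|//|phip1 phi11] := phis1.
    apply/eqP => A0; move: phi11; rewrite A0 (positive_on0 sub1 phip1).
    by move/eqP; rewrite eq_sym oner_eq0.
  have norming h : star h = h -> exists2 psi : A -> R[i], state psi &
      psi (h + `|h| *: csone) = `|h + `|h| *: csone|.
    move=> hs; apply: pos_norming_state => //.
    (* Applied to - h, this gives the positivity of h + |h|. *)
    have := pos_norm_sub (_ : star (- h) = - h).
    by rewrite starN hs normrN opprK addrC; apply.
  have [psi1 psis1 psia] := norming a sa; have [psi2 psis2 psib] := norming b sb.
  have [||phi phis [dom1 dom2]] := ind psi1 psi2.
  - exact: state_on_subset psis1.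
  - exact: state_on_subset psis2.
  have /state_onP[//|//|phip phi11] := phis.
  have le1 : phi1 a <= phi a.
    apply: (state_le_dominated (M := M%:C%C) sub1 o1 Ba sa psis1 phis phis1 psia) => c Bc pc.
    (* Only the upper bound of module independence is used, at x = z0 c, where |x| = c. *)
    have /dom1[_] : E1 (z0 <* c) by apply/(inner_spanE hz0 E1_ternary E1z0).
    by rewrite (hmabs_z0 hz0 pc).
  have le2 : phi2 b <= phi b.
    apply: (state_le_dominated (M := M%:C%C) sub2 o2 Bb sb psis2 phis phis2 psib) => c Bc pc.
    have /dom2[_] : E2 (z0 <* c) by apply/(inner_spanE hz0 E2_ternary E2z0).
    by rewrite (hmabs_z0 hz0 pc).
  rewrite (le_trans (lerD le1 le2))// -(positive_onD phip)//.
  rewrite (le_trans (positive_on_sa_le subA A1 phip _ _)) ?starD ?sa ?sb//.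
  by rewrite phi11 mul1r.
exists 1, 1; split=> // phi1 phi2 phis1 phis2.
have [phi phis [ext1 ext2]] := ind _ _ phis1 phis2; exists phi => //.
have bounds B (chi : A -> R[i]) h : cstar_subalgebra B -> B csone ->
    state_on B chi -> B h -> pos h -> phi h = chi h ->
    1%:C%C * chi h <= phi h /\ phi h <= 1%:C%C * sqrtC (chi (h ** h)).
  move=> subB B1 /state_onP[//|//|chip chi1] Bh ph ->; rewrite !mul1r; split=> //.
  have chi0 : 0 <= chi h by exact: positive_on_ge0 Bh ph.
  rewrite -[leLHS]sqrCK// ler_sqrtC ?qualifE /= ?exprn_ge0//.
  - exact: (positive_on_sq_le subB B1 chip Bh ph.1 chi1).
  - by rewrite -{1}ph.1 chip.2.
split=> x Fx.
  have [Bx px] := hmabs_span hz0 E1_ternary E1z0 Fx.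
  by apply: (bounds (inner_span E1)) => //; exact: ext1.
have [Bx px] := hmabs_span hz0 E2_ternary E2z0 Fx.
by apply: (bounds (inner_span E2)) => //; exact: ext2.
Qed.
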